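(* Let $L$ be a finite supersolvable lattice such that $\mu(x,y)\ne 0$ whenever $x,y\in L$ and $x<y$, and let $\Delta=\Delta(L\setminus\{\hat 0,\hat 1\})$ be the order complex of the proper part of $L$. Then $\Delta$ admits a convex-ear decomposition.
   Context: A lattice $L$ is supersolvable if it has a maximal chain $\mathbf c$ (an M-chain) such that for every (not necessarily maximal) chain $\mathbf d$ of $L$ the sublattice generated by $\mathbf c$ and $\mathbf d$ is distributive. $\mu$ is the Möbius function of $L$: $\mu(x,x)=1$, $\mu(x,y)=-\sum_{x\le z<y}\mu(x,z)$ for $x<y$. The order complex $\Delta(P)$ of a poset $P$ is the simplicial complex whose simplices are the chains of $P$. A $(d-1)$-dimensional simplicial complex $\Delta$ admits a convex-ear decomposition if there are subcomplexes $\Sigma_1,\dots,\Sigma_n$ such that: (i) $\bigcup_{i=1}^n\Sigma_i=\Delta$; (ii) $\Sigma_1$ is the boundary complex of a simplicial $d$-polytope, and for $i>1$, $\Sigma_i$ is a full-dimensional (i.e. $(d-1)$-dimensional) proper subcomplex of the boundary complex of some simplicial $d$-polytope; (iii) for $i>1$, $\Sigma_i$ is a simplicial ball; (iv) for $i>1$, $\left(\bigcup_{j=1}^{i-1}\Sigma_j\right)\cap\Sigma_i=\partial\Sigma_i$. (Being a boundary complex, or subcomplex thereof, is meant up to isomorphism of simplicial complexes.) *)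

(* Defs.v *)
From HB Require Import structures.
From mathcomp Require Import all_boot all_order all_algebra finmap.
From mathcomp Require Import all_classical all_reals all_analysis.

Set Implicit Arguments.
Unset Strict Implicit.
Unset Printing Implicit Defensive.

Import Order.TTheory GRing.Theory Num.Theory.
Import numFieldNormedType.Exports.

Local Open Scope classical_set_scope.
Local Open Scope ring_scope.

Section Lattices.
Variables (disp : Order.disp_t) (L : finTBLatticeType disp).

Definition chain (C : {pred L}) : Prop := {in C &, forall x y, (x >=< y)%O}.

Definition maximal_chain (c : {set L}) : Prop :=
  chain (mem c) /\
  forall c' : {set L}, chain (mem c') -> c \subset c' -> c' = c.

Definition sublattice (S : {set L}) : bool :=
  [forall x in S, forall y in S, ((x `&` y)%O \in S) && ((x `|` y)%O \in S)].

Definition sublattice_generated (X : {set L}) : {set L} :=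
  (\bigcap_(S : {set L} | sublattice S && (X \subset S)) S)%SET.

Definition distributive_on (S : {set L}) : Prop :=
  {in S & &, forall x y z, (x `&` (y `|` z) = (x `&` y) `|` (x `&` z))%O}.

Definition M_chain (c : {set L}) : Prop :=
  maximal_chain c /\
  forall d : {set L}, chain (mem d) ->
    distributive_on (sublattice_generated (c :|: d)%SET).

Definition supersolvable : Prop := exists c : {set L}, M_chain c.

(* [n] is recursion fuel: any [n] exceeding the number of [z] with
   [x <= z < y] gives the same value; see [mobius_refl] and [mobius_lt]. *)
Fixpoint mobius_rec (n : nat) (x y : L) : int :=
  if n is n'.+1 then
    if x == y then 1
    else if (x < y)%O then - \sum_(z : L | (x <= z < y)%O) mobius_rec n' x z
    else 0
  else 0.

Definition mobius (x y : L) : int := mobius_rec #|L| x y.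

Lemma mobius_rec_fuel n m x y :
  (#|[pred z : L | x <= z < y]%O| < n)%N ->
  (#|[pred z : L | x <= z < y]%O| < m)%N ->
  mobius_rec n x y = mobius_rec m x y.
Proof.
elim: n m y => [|n IHn] [|m] y //= ltn ltm.
case: eqP => // _; case: ifP => // _; congr (- _).
apply: eq_bigr => z /andP[xz zy].
have lt : (#|[pred t : L | x <= t < z]%O| < #|[pred t : L | x <= t < y]%O|)%N.
  apply: proper_card; apply/properP; split.
    apply/fintype.subsetP => t; rewrite !inE => /andP[-> tz] /=.
    exact: lt_trans tz zy.
  by exists z; rewrite !inE ?xz ?zy ?ltxx ?andbF.
by apply: IHn; [exact: leq_trans lt ltn | exact: leq_trans lt ltm].
Qed.

Lemma mobius_refl x : mobius x x = 1.
Proof.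
rewrite /mobius; have : (0 < #|L|)%N by apply/card_gt0P; exists x.
by case: #|L| => //= n _; rewrite eqxx.
Qed.

Lemma mobius_lt x y : (x < y)%O ->
  mobius x y = - \sum_(z : L | (x <= z < y)%O) mobius x z.
Proof.
have itv_lt t : (#|[pred z : L | x <= z < t]%O| < #|L|)%N.
  apply: proper_card; apply/properP; split; first exact/fintype.subsetP.
  by exists t; rewrite // !inE ltxx andbF.
move=> xy; rewrite {1}/mobius (@mobius_rec_fuel _ #|L|.+1) ?itv_lt //=; last first.
  exact: ltnW (itv_lt y).
by rewrite (lt_eqF xy) xy.
Qed.

(* The simplices of a complex on a vertex type [T] are finite sets; the empty
   set is always one of them. *)
Definition order_complex (P : {pred L}) : set {fset L} :=
  [set s | {subset s <= P} /\ chain (mem s)].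

Definition proper_part : {pred L} :=
  [pred x : L | (x != \bot%O) && (x != \top%O)].

End Lattices.

Section Complexes.
Variable T : choiceType.
Implicit Types (K : set {fset T}) (s t F G : {fset T}).

Definition simplicial_complex K : Prop :=
  K fset0 /\ forall s t, K s -> fsubset t s -> K t.

Definition subcomplex K' K : Prop := simplicial_complex K' /\ K' `<=` K.

Definition complex_vertices K : set T := [set v | K (fset1 v)].

(* [card_dim K d] says that [K] has dimension [d - 1]; the shift makes
   the dimension -1 of the complex whose only simplex is empty expressible. *)
Definition card_dim K (d : nat) : Prop :=
  (exists2 s, K s & #|` s| = d) /\ forall s, K s -> (#|` s| <= d)%N.

Definition facet K F : Prop := K F /\ forall G, K G -> fsubset F G -> G = F.

(* For a simplicial ball: the complex generated by the codimension one faces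
   lying in exactly one facet. *)
Definition boundary K : set {fset T} :=
  [set t | exists s F,
     [/\ fsubset t s,
         facet K F, fsubset s F, #|` F| = (#|` s|).+1
       & forall G, facet K G -> fsubset s G -> G = F]].

End Complexes.

(* Points are given by barycentric coordinates. The product topology is the
   usual one as soon as [K] is finite. *)
Definition geometric_realization (R : realType) (T : choiceType)
    (K : set {fset T}) : set {ptws T -> R} :=
  [set x | exists s,
     [/\ K s, forall v, 0 <= x v, forall v, v \notin s -> x v = 0
       & \sum_(v <- s) x v = 1]].

Arguments geometric_realization R {T} K _.

Definition complex_iso (T U : choiceType)
    (K : set {fset T}) (K' : set {fset U}) : Prop :=
  exists f : T -> U,
    {in complex_vertices K &, injective f} /\
    K' = [set (f @` s)%fset | s in K].

Definition homeomorphic (X Y : topologicalType) (A : set X) (B : set Y) : Prop :=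
  exists (f : X -> Y) (g : Y -> X),
    [/\ {within A, continuous f} /\ {within B, continuous g},
        f @` A `<=` B, g @` B `<=` A,
        forall x, A x -> g (f x) = x & forall y, B y -> f (g y) = y].

Definition euclidean_ball (R : realType) (k : nat) : set 'rV[R]_k :=
  [set x | \sum_(i < k) x 0 i ^+ 2 <= 1].

Arguments euclidean_ball R k _ : clear implicits.

Definition simplicial_ball (R : realType) (T : choiceType)
    (K : set {fset T}) : Prop :=
  simplicial_complex K /\
  exists k, homeomorphic (geometric_realization R K) (euclidean_ball R k).

Section Polytopes.
Variables (R : realType) (m : nat).
Implicit Types (A P F : set 'rV[R]_m) (s : {fset 'rV[R]_m}).

Definition conv_hull s : set 'rV[R]_m :=
  [set x | exists w : 'rV[R]_m -> R,
     [/\ forall v, v \in s -> 0 <= w v, \sum_(v <- s) w v = 1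
       & x = \sum_(v <- s) w v *: v]].

Definition affinely_independent s : Prop :=
  forall w : 'rV[R]_m -> R,
    \sum_(v <- s) w v = 0 -> \sum_(v <- s) w v *: v = 0 ->
    forall v, v \in s -> w v = 0.

Definition affine_dim A (d : nat) : Prop :=
  (exists s, [/\ [set` s] `<=` A, affinely_independent s & #|` s| = d.+1]) /\
  forall s, [set` s] `<=` A -> affinely_independent s -> (#|` s| <= d.+1)%N.

Definition polytope P (d : nat) : Prop :=
  (exists s, P = conv_hull s) /\ affine_dim P d.

(* [a = 0] is allowed, so that the empty set and [P] itself are faces. *)
Definition face P F : Prop :=
  exists (a : 'rV[R]_m) (b : R),
    (forall x, P x -> \sum_(i < m) a 0 i * x 0 i <= b) /\
    F = [set x | P x /\ \sum_(i < m) a 0 i * x 0 i = b].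

Definition proper_face P F : Prop := face P F /\ F <> P.

Definition polytope_vertices P : set 'rV[R]_m := [set v | face P [set v]].

Definition is_simplex F : Prop :=
  exists2 s, affinely_independent s & F = conv_hull s.

Definition simplicial_polytope P (d : nat) : Prop :=
  polytope P d /\ forall F, proper_face P F -> is_simplex F.

Definition boundary_complex P : set {fset 'rV[R]_m} :=
  [set s | exists2 F, proper_face P F & [set` s] = polytope_vertices P `&` F].

End Polytopes.

(* The subcomplexes are indexed from 0, so the first one is [Sigma ord0]. *)
Definition convex_ear_decomposition (R : realType) (T : choiceType)
    (Delta : set {fset T}) (d n : nat) (Sigma : 'I_n.+1 -> set {fset T}) : Prop :=
  [/\ forall i, subcomplex (Sigma i) Delta,
      \bigcup_i Sigma i = Delta,
      exists (m : nat) (P : set 'rV[R]_m),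
        simplicial_polytope P d /\
        complex_iso (Sigma ord0) (boundary_complex P),
      forall i : 'I_n.+1, (0 < i)%N ->
        card_dim (Sigma i) d /\
        exists (m : nat) (P : set 'rV[R]_m) (K : set {fset 'rV[R]_m}),
          [/\ simplicial_polytope P d, subcomplex K (boundary_complex P),
              K <> boundary_complex P & complex_iso (Sigma i) K]
    & forall i : 'I_n.+1, (0 < i)%N ->
        simplicial_ball R (Sigma i) /\
        (\bigcup_(j in [set j : 'I_n.+1 | (j < i)%N]) Sigma j) `&` Sigma i
          = boundary (Sigma i)].

Definition admits_convex_ear_decomposition (R : realType) (T : choiceType)
    (Delta : set {fset T}) : Prop :=
  exists d : nat, [/\ simplicial_complex Delta, card_dim Delta d
    & exists (n : nat) (Sigma : 'I_n.+1 -> set {fset T}),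
        convex_ear_decomposition R Delta d Sigma].

(* Main.v *)
From HB Require Import structures.
Require Import Defs.
From mathcomp Require Import fingroup perm.
From mathcomp Require Import all_boot all_order all_algebra finmap.
From mathcomp Require Import all_classical all_reals all_analysis.
From mathcomp Require Import lra.

(* Write c = (c_0 < ... < c_n) for the M-chain and let [labels u] be the set of
   i with c_{i+1} <= c_i \/ u.  On a distributive sublattice containing c this
   is an embedding of lattices into the subsets of [n].  Since the Moebius
   function does not vanish on intervals of length two, a chain with an ascent
   of labels can be modified so that the sublattice it generates with c grows;
   hence every chain lies in a sublattice D_i on which [labels] is onto, i.e.
   in a Boolean lattice, whose order complex is the boundary of the dual
   permutohedron.

   The ears are generated by the flags of D_i that lie in no earlier D_j.  As
   the D_j are closed under the lattice operations and contain c, the new flags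
   form an upper ideal of the weak order.  In the Coxeter fan this means that
   the union of their chambers is the epigraph, in the direction
   (1, 2, ..., n), of a continuous homogeneous function; so it is homeomorphic
   to a half-space and its link is a ball.  The boundary condition says that
   galleries from new to old flags around a simplex cross a wall. *)

Set Implicit Arguments.
Unset Strict Implicit.
Unset Printing Implicit Defensive.

Import Order.TTheory GRing.Theory Num.Theory.
Import numFieldNormedType.Exports.

Local Open Scope ring_scope.

(** * Boolean sublattices containing the M-chain *)

(** One fact carries the order theory: a family of sets closed under union and intersection and
    containing the empty and the full set contains every set whose points it separates from the
    points outside ([separating_family]). Prefixes, the images of the M-chain, already separate [a]
    from [b] whenever [a < b], so only pairs with [b < a] matter. This makes [labels] onto for a
    chain with descending labels, and it is why being old passes down the weak order.

    The Boolean frames may be listed in any order, since a flag is compared only with the frames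
    listed before.

    A ball is meant in the topological sense, so a shelling alone would not conclude; the epigraph
    yields explicit inverse maps. It needs a finite height function, that is, an ascent in each new
    flag: the decreasing flag consists of elements of the M-chain, so it is never new after the
    first ear. *)

Section SeparatingFamily.
Variables (T : finType) (F : {pred {set T}}).
Hypotheses (F0 : finset.set0 \in F) (F1 : finset.setT \in F).
Hypothesis FU : {in F &, forall A B, (A :|: B)%SET \in F}.
Hypothesis FI : {in F &, forall A B, (A :&: B)%SET \in F}.

(** For each [a] in [S], intersecting members that separate [a] from the points outside [S] gives a
    member that contains [a] and lies inside [S]; [S] is the union of these. [F0] and [F1] serve for
    the empty union and the empty intersection. *)
Lemma separating_family (S : {set T}) :
    (forall a b, a \in S -> b \notin S ->
       exists A : {set T}, [/\ A \in F, a \in A & b \notin A]) ->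
  S \in F.
Proof.
move=> sep.
have sepa a : a \in S -> exists2 A : {set T}, A \in F & (a \in A) && (A \subset S).
  move=> aS; pose A b := if [pick A : {set T} | [&& A \in F, a \in A & b \notin A]]
    is Some A then A else finset.setT.
  have AP b : b \notin S -> [&& A b \in F, a \in A b & b \notin A b].
    move=> bS; rewrite /A; case: pickP => [A' //|noA].
    by have [A' [? ? ?]] := sep a b aS bS; have := noA A'; rewrite !inE; move/and3P; case.
  exists (\bigcap_(b in ~: S) A b)%SET; first by apply: (big_ind (fun X => X \in F)) => // b; rewrite inE => /AP/and3P[].
  apply/andP; split; first by apply/bigcapP => b; rewrite inE => /AP/and3P[].
  apply/fintype.subsetP => b /bigcapP bA; apply: contraT => bS.
  by have /and3P[_ _ /negP[]] := AP b bS; apply: bA; rewrite inE.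
have -> : S = (\bigcup_(A : {set T} | (A \in F) && (A \subset S)) A)%SET.
  apply/eqP; rewrite finset.eqEsubset; apply/andP; split.
    apply/fintype.subsetP => a /sepa[A AF /andP[aA AS]].
    by apply/bigcupP; exists A; rewrite // AF.
  by apply/bigcupsP => A /andP[].
by apply: (big_ind (fun X => X \in F)) => // A /andP[].
Qed.

End SeparatingFamily.

Section MaximalChains.
Variables (disp : Order.disp_t) (L : finTBLatticeType disp).
Implicit Types (x y : L) (C : {set L}).

Definition covers x y : Prop := (x < y)%O /\ forall z, ~ (x < z < y)%O.

Lemma maximal_chain_exists C :
  chain (mem C) -> exists2 C' : {set L}, maximal_chain C' & C \subset C'.
Proof.
move=> chC; have [|C' /maxsetP[/asboolP chC' maxC'] CC'] :=
  @maxset_exists L (fun A => `[< chain (mem A) >]) C; first exact/asboolP.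
exists C' => //; split=> // D chD C'D; apply: maxC' => //; exact/asboolP.
Qed.

Lemma maximal_chain_in C x :
  maximal_chain C -> {in C, forall y, (x >=< y)%O} -> x \in C.
Proof.
move=> [chC maxC] xC.
have <- : (x |: C)%SET = C; last by rewrite finset.setU11.
apply: maxC; last exact: finset.subsetUr.
move=> y z; rewrite !inE => /orP[/eqP->|yC] /orP[/eqP->|zC].
- exact: comparablexx.
- exact: xC.
- by rewrite comparable_sym xC.
- exact: chC.
Qed.

Lemma maximal_chain_enum C : maximal_chain C ->
  exists (n : nat) (e : nat -> L),
    [/\ e 0%N = \bot%O, e n = \top%O,
        forall k, (k < n)%N -> covers (e k) (e k.+1)
      & forall x, x \in C <-> exists2 k, (k <= n)%N & x = e k].
Proof.
move=> maxC; have [chC _] := maxC.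
pose s := sort (<=%O) (enum C).
have ms x : (x \in s) = (x \in C) by rewrite mem_sort mem_enum.
have sts : sorted (<=%O) s.
  apply: (@sort_sorted_in _ (mem C)); last by apply/allP => x; rewrite mem_enum.
  exact: chC.
have us : uniq s by rewrite sort_uniq enum_uniq.
have lts : sorted (<%O) s by rewrite lt_sorted_uniq_le us.
have botC : \bot%O \in C.
  by apply: maximal_chain_in => // y _; rewrite /Order.comparable le0x.
have topC : \top%O \in C.
  by apply: maximal_chain_in => // y _; rewrite /Order.comparable lex1 orbT.
have s_gt0 : (0 < size s)%N by rewrite size_sort -cardE; apply/card_gt0P; exists \bot%O.
pose e := nth \bot%O s.
have eC k : (k < size s)%N -> e k \in C by move=> ks; rewrite -ms mem_nth.
have elt i j : (i < size s)%N -> (j < size s)%N -> (e i < e j)%O = (i < j)%N.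
  by move=> si sj; apply: lt_sorted_ltn_nth.
have ele i j : (i < size s)%N -> (j < size s)%N -> (e i <= e j)%O = (i <= j)%N.
  by move=> si sj; apply: lt_sorted_leq_nth.
have eP x : x \in C <-> exists2 k, (k <= (size s).-1)%N & x = e k.
  rewrite -ms; split=> [/(nthP \bot%O)[k ks <-]|[k ks ->]].
    by exists k => //; rewrite -ltnS prednK.
  by apply: mem_nth; rewrite -(prednK s_gt0) ltnS.
exists (size s).-1, e; split=> //.
- have [k ks k0] := (eP _).1 botC; apply/le_anti; rewrite le0x andbT k0 ele //.
  by rewrite -(prednK s_gt0) ltnS.
- have [k ks k1] := (eP _).1 topC; apply/le_anti; rewrite lex1 /= k1 ele //.
    by rewrite -(prednK s_gt0) ltnS.
  by rewrite ltn_predL.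
move=> k; rewrite ltn_predRL => ks; split; first by rewrite elt // ltnW.
move=> z /andP[kz zk].
have /(proj1 (eP _))[j] : z \in C.
  apply: maximal_chain_in => // y /(proj1 (eP _))[j]; rewrite -ltnS prednK // => js ->.
  have [jk|kj] := leqP j k.
    by rewrite /Order.comparable [(e j <= z)%O](le_trans _ (ltW kz)) ?orbT ?ele // ltnW.
  by rewrite /Order.comparable [(z <= e j)%O](le_trans (ltW zk)) ?ele.
rewrite -ltnS prednK // => js zE; have k1s := ltnW ks.
by move: kz zk; rewrite zE !elt // => kj; rewrite ltnS leqNgt kj.
Qed.

End MaximalChains.

Section SublatticeGenerated.
Variables (disp : Order.disp_t) (L : finTBLatticeType disp).
Implicit Types (x y : L) (S X : {set L}).

Lemma sublatticeP S :
  reflect {in S &, forall x y, (x `&` y)%O \in S /\ (x `|` y)%O \in S}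
          (sublattice S).
Proof.
apply: (iffP forall_inP) => [SP x y xS yS|SP x xS].
  by have /forall_inP/(_ y yS)/andP := SP x xS.
by apply/forall_inP => y yS; apply/andP; apply: SP.
Qed.

Lemma sub_sublattice_generated X : X \subset sublattice_generated X.
Proof. by apply/bigcapsP => S /andP[]. Qed.

Lemma sublattice_generated_min S X :
  sublattice S -> X \subset S -> sublattice_generated X \subset S.
Proof. by move=> lS XS; apply: (finset.bigcap_inf S); apply/andP. Qed.

Lemma sublattice_generated_sublattice X : sublattice (sublattice_generated X).
Proof.
apply/sublatticeP => x y /bigcapP xX /bigcapP yX.
by split; apply/bigcapP => S SX; have [/sublatticeP/(_ x y (xX _ SX) (yX _ SX))[]] := andP SX.
Qed.

End SublatticeGenerated.

(* For a cover [x < y] the sets of labels of [x] and [y] differ by the label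
   of the edge [x < y] in the usual S_n EL-labelling attached to the chain [c]. *)
HB.lock Definition labels (disp : Order.disp_t) (L : finTBLatticeType disp)
    (n : nat) (c : nat -> L) (u : L) : {set 'I_n} :=
  [set i : 'I_n | (c i.+1 <= c i `|` u)%O]%SET.

Section Labels.
Variables (disp : Order.disp_t) (L : finTBLatticeType disp).
Variables (n : nat) (c : nat -> L).
Hypotheses (c0 : c 0%N = \bot%O) (cn : c n = \top%O).
Hypothesis c_covers : forall k, (k < n)%N -> covers (c k) (c k.+1).
Implicit Types (x y u v : L) (D : {set L}).

Local Notation labels := (labels n c).

Definition prefix k : {set 'I_n} := [set i : 'I_n | (i < k)%N]%SET.

Definition distributive_frame D : Prop :=
  [/\ sublattice D, distributive_on D & forall k, (k <= n)%N -> c k \in D].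

Lemma in_labels u i : (i \in labels u) = (c i.+1 <= c i `|` u)%O.
Proof. by rewrite labels.unlock inE. Qed.

Lemma c_mono i j : (i <= j)%N -> (j <= n)%N -> (c i <= c j)%O.
Proof.
elim: j => [|j IHj]; first by rewrite leqn0 => /eqP->.
rewrite leq_eqVlt => /predU1P[-> //|ij] jn.
exact: le_trans (IHj ij (ltnW jn)) (ltW (c_covers jn).1).
Qed.

Lemma labels_bot : labels \bot%O = finset.set0.
Proof.
apply/setP => i; rewrite in_labels !inE joinx0.
by rewrite lt_geF ?(c_covers (ltn_ord i)).1.
Qed.

Lemma labels_top : labels \top%O = finset.setT.
Proof. by apply/setP => i; rewrite in_labels !inE joinx1 lex1. Qed.

Lemma labels_c k : (k <= n)%N -> labels (c k) = prefix k.
Proof.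
move=> kn; apply/setP => i; rewrite in_labels !inE; have [ik|ki] := ltnP i k.
  by rewrite (join_idPr _) ?c_mono // ltnW.
rewrite (join_idPl _); last exact: c_mono ki (ltnW _).
by rewrite lt_geF ?(c_covers (ltn_ord i)).1.
Qed.

Section OnFrame.
Variable D : {set L}.
Hypothesis frameD : distributive_frame D.
Let latD : {in D &, forall x y, (x `&` y)%O \in D /\ (x `|` y)%O \in D}.
Proof. by have [/sublatticeP] := frameD. Qed.
Let distD : {in D & &, forall x y z, (x `&` (y `|` z) = (x `&` y) `|` (x `&` z))%O}.
Proof. by have [] := frameD. Qed.
Let cD k : (k <= n)%N -> c k \in D.
Proof. by have [_ _] := frameD; apply. Qed.

Lemma frame_meet x y : x \in D -> y \in D -> (x `&` y)%O \in D.
Proof. by move=> xD yD; have [] := latD xD yD. Qed.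

Lemma frame_join x y : x \in D -> y \in D -> (x `|` y)%O \in D.
Proof. by move=> xD yD; have [] := latD xD yD. Qed.

(** The join of [c i] with the meet of [c i.+1] and [u] lies between [c i] and its cover [c i.+1],
    so it is one of the two. The resulting criterion by meets is the one that distributes over
    joins, as the defining criterion by joins does not. *)
Lemma mem_labels u (i : 'I_n) : u \in D ->
  (i \in labels u) = ~~ (c i.+1 `&` u <= c i)%O.
Proof.
move=> uD; have [lti cov] := c_covers (ltn_ord i).
have iD := cD (ltnW (ltn_ord i)); have i1D := cD (ltn_ord i).
rewrite in_labels; apply/idP/idP => [le1|nle].
  have E : (c i.+1 = c i `|` (c i.+1 `&` u))%O.
    by rewrite -[LHS](meet_idPl le1) distD // (meet_idPr (ltW lti)).
  apply/negP => le2; move: lti; rewrite {1}E (join_idPl le2) ltxx; exact/negP.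
have ltj : (c i < c i `|` (c i.+1 `&` u))%O.
  by rewrite lt_neqAle leUl andbT; apply: contraNneq nle => ->; rewrite leUr.
have lej : (c i `|` (c i.+1 `&` u) <= c i.+1)%O by rewrite leUx (ltW lti) leIl.
have := cov (c i `|` (c i.+1 `&` u))%O; rewrite ltj lt_neqAle lej andbT.
have [<- _|//] := eqVneq (c i `|` (c i.+1 `&` u))%O (c i.+1).
  by apply: leU2 => //; exact: leIr.
Qed.

Lemma labels_join u v : u \in D -> v \in D ->
  labels (u `|` v)%O = (labels u :|: labels v)%SET.
Proof.
move=> uD vD; apply/setP => i; rewrite finset.in_setU !mem_labels // ?frame_join //.
by rewrite distD ?cD ?ltn_ord // leUx negb_and.
Qed.

Lemma labels_meet u v : u \in D -> v \in D ->
  labels (u `&` v)%O = (labels u :&: labels v)%SET.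
Proof.
move=> uD vD; apply/setP => i; rewrite finset.in_setI.
have [lti cov] := c_covers (ltn_ord i).
have iD := cD (ltnW (ltn_ord i)); have i1D := cD (ltn_ord i).
apply/idP/idP => [|/andP[iu iv]].
  rewrite !in_labels => le1.
  by rewrite !(le_trans le1) // leU2 // ?leIl ?leIr.
rewrite mem_labels ?frame_meet //; apply/negP => le0.
move: iu; rewrite mem_labels // => /negP; apply.
move: iv; rewrite in_labels => iv.
have -> : (c i.+1 `&` u = (c i.+1 `&` u) `&` (c i `|` v))%O.
  by apply/esym/meet_idPl; apply: le_trans iv; exact: leIl.
rewrite distD ?frame_meet // leUx leIr /= -meetA; exact: le0.
Qed.

(** The order is recovered by climbing the M-chain: if the meet of [u] with [c k] is below [v], so
    is the meet with [c k.+1], either because [k] labels [v] or because [k] does not label [u]. *)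
Lemma labels_le u v : u \in D -> v \in D ->
  (u <= v)%O = (labels u \subset labels v).
Proof.
move=> uD vD; apply/idP/idP => [uv|sub].
  apply/fintype.subsetP => i; rewrite !in_labels => /le_trans; apply.
  exact: leU2.
suff H k : (k <= n)%N -> (u `&` c k <= v)%O by move: (H n (leqnn n)); rewrite cn meetx1.
elim: k => [|k IHk] kn; first by rewrite c0 meetx0 le0x.
have {IHk} le_k := IHk (ltnW kn).
have iD := cD (ltnW kn); have i1D := cD kn.
have [iu|] := boolP (Ordinal kn \in labels u).
  have := fintype.subsetP sub _ iu; rewrite in_labels /= => iv.
  have -> : (u `&` c k.+1 = (u `&` c k.+1) `&` (c k `|` v))%O.
    by apply/esym/meet_idPl; apply: le_trans iv; exact: leIr.
  rewrite distD ?frame_meet // leUx leIr andbT; apply: le_trans le_k.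
  by rewrite leI2 // leIl.
rewrite mem_labels // negbK /= => le1; apply: le_trans le_k.
by rewrite lexI leIl meetC.
Qed.

Lemma labels_inj : {in D &, injective labels}.
Proof.
move=> u v uD vD E; apply/le_anti.
by rewrite !labels_le // E fintype.subxx.
Qed.

End OnFrame.

End Labels.

(** * Enlarging the frame of a chain to a Boolean one *)

Section BooleanFrames.
Variables (disp : Order.disp_t) (L : finTBLatticeType disp).
Variables (n : nat) (c : nat -> L) (C : {set L}).
Hypotheses (c0 : c 0%N = \bot%O) (cn : c n = \top%O).
Hypothesis c_covers : forall k, (k < n)%N -> covers (c k) (c k.+1).
Hypothesis CP : forall x, x \in C <-> exists2 k, (k <= n)%N & x = c k.
Hypothesis C_dist : forall d : {set L}, chain (mem d) ->
  distributive_on (sublattice_generated (C :|: d)%SET).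
Hypothesis mobius_neq0 : forall x y : L, (x < y)%O -> mobius x y <> 0.
Implicit Types (x y z u v : L) (D d : {set L}).

Local Notation labels := (labels n c).
Local Notation prefix := (prefix n).
Local Notation frame d := (sublattice_generated (C :|: d)%SET).

Lemma frame_distributive d : chain (mem d) -> distributive_frame n c (frame d).
Proof.
move=> chd; split; [exact: sublattice_generated_sublattice|exact: C_dist|].
move=> k kn; apply: (fintype.subsetP (sub_sublattice_generated _)).
by rewrite finset.in_setU; apply/orP; left; apply/CP; exists k.
Qed.

Lemma mem_frame d x : x \in d -> x \in frame d.
Proof.
move=> xd; apply: (fintype.subsetP (sub_sublattice_generated _)).
by rewrite finset.in_setU xd orbT.
Qed.

Lemma chain3 x y z : (x <= y)%O -> (y <= z)%O -> chain (mem [set x; y; z]%SET).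
Proof.
move=> xy yz; have xz := le_trans xy yz.
by move=> u v; rewrite !inE => /orP[/orP[]|] /eqP-> /orP[/orP[]|] /eqP->;
  rewrite /Order.comparable ?lexx ?xy ?yz ?xz ?orbT.
Qed.

(** [L] itself need not be distributive: identities on labels of comparable elements are proved
    inside the frame that these elements generate with the M-chain. *)
Lemma frame3 x y z : (x <= y)%O -> (y <= z)%O ->
  exists D, [/\ distributive_frame n c D, x \in D, y \in D & z \in D].
Proof.
move=> xy yz; exists (frame [set x; y; z]%SET); split.
- by apply: frame_distributive; exact: chain3.
- by apply: mem_frame; rewrite !inE eqxx.
- by apply: mem_frame; rewrite !inE eqxx orbT.
- by apply: mem_frame; rewrite !inE eqxx orbT.
Qed.

Lemma labels_homo x y : (x <= y)%O -> labels x \subset labels y.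
Proof.
by move=> xy; have [D [? ? ? _]] := frame3 xy (lexx y); rewrite -(labels_le c0 cn c_covers (D := D)).
Qed.

Lemma labels_proper x y : (x < y)%O -> labels x \proper labels y.
Proof.
move=> xy; have [D [frD xD yD _]] := frame3 (ltW xy) (lexx y).
rewrite finset.properEneq labels_homo ?(ltW xy) // andbT.
by apply: contraTneq xy => /(labels_inj c0 cn c_covers frD xD yD) ->; rewrite ltxx.
Qed.

Lemma labels_between x y k : (k <= n)%N -> (x <= y)%O ->
  labels (x `|` (c k `&` y))%O = (labels x :|: (prefix k :&: labels y))%SET.
Proof.
move=> kn xy; have [D [frD xD yD _]] := frame3 xy (lexx y).
have kD : c k \in D by have [_ _] := frD; apply.
rewrite (labels_join c_covers frD) ?(frame_meet frD) //.
by rewrite (labels_meet c_covers frD) // labels_c.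
Qed.

(** For [i] in [labels y] but not in [labels x], the join of [x] with the meet of [c i.+1] and [y]
    lies between [x] and [y] and is not [x], so it is [y]; hence all new labels are at most [i]. Any
    two new labels bound each other. *)
Lemma labels_covers x y : covers x y ->
  exists2 a, a \notin labels x & labels y = (a |: labels x)%SET.
Proof.
move=> [xy cov].
have H i : i \in labels y -> i \notin labels x ->
    labels y = (labels x :|: (prefix i.+1 :&: labels y))%SET.
  move=> iy ix; rewrite -labels_between ?(ltW xy) ?ltn_ord //.
  set u := (_ `|` _)%O; have xu : (x <= u)%O by rewrite leUl.
  have uy : (u <= y)%O by rewrite leUx (ltW xy) leIr.
  have [<- //|uNy] := eqVneq u y.
  have := cov u; rewrite !lt_neqAle uy uNy xu !andbT.
  have [xE|_ /(_ isT)//] := eqVneq x u.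
  move: ix; rewrite xE labels_between ?(ltW xy) ?ltn_ord //.
  by rewrite !inE ltnSn iy orbT.
have /properP[sub [a ay ax]] := labels_proper xy.
exists a => //; apply/setP => b; rewrite finset.in_setU1.
apply/idP/predU1P => [yb'|[->//|xb]]; last exact: (fintype.subsetP sub).
have [bx|bx] := boolP (b \in labels x); [by right|left].
have le_lab i j : i \in labels y -> i \notin labels x ->
    j \in labels y -> j \notin labels x -> (j <= i)%N.
  move=> iy ix jy jx; have := jy; rewrite (H i iy ix) finset.in_setU (negbTE jx).
  by rewrite finset.in_setI inE ltnS => /andP[].
by apply/val_inj/eqP; rewrite /= eqn_leq !le_lab.
Qed.

Lemma mobius_covers x y : covers x y -> mobius x y = -1.
Proof.
move=> [xy cov]; rewrite mobius_lt // (big_pred1 x) ?mobius_refl // => z /=.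
have [->|zx] := eqVneq z x; first by rewrite lexx xy.
by apply/negP => /andP[xz zy]; apply: (cov z); rewrite lt_neqAle eq_sym zx xz.
Qed.

(** Were [y] the only element strictly inside, the Moebius value at [x] and [z] would be the
    opposite of [1 - 1]. *)
Lemma rank2_interval x y z : covers x y -> covers y z ->
  exists2 y', (x < y' < z)%O & y' != y.
Proof.
move=> cxy [yz _]; have [xy _] := cxy; have xz := lt_trans xy yz.
apply/exists2P/not_existsP => noy; apply: (mobius_neq0 xz).
rewrite mobius_lt // (bigD1 x) ?lexx ?xz //= (bigD1 y) /=; last first.
  by rewrite (ltW xy) yz gt_eqF.
rewrite mobius_refl mobius_covers // big1 ?addr0 ?subrr ?oppr0 // => u.
move=> /andP[/andP[/andP[xu uz] ux] uy]; case: (noy u); split=> //.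
by rewrite lt_neqAle eq_sym ux xu uz.
Qed.

(** Labels are injective on frames, so only one element strictly between [x] and [z] can omit the
    larger label [b], and it is given by a formula in [x], [z] and [c a.+1]. That element is [y];
    any other one contains [b], and omits [a] because it is below [z]. *)
Lemma ascent_swap x y z (a b : 'I_n) : covers x y -> covers y z -> (a < b)%N ->
    a \notin labels x -> labels y = (a |: labels x)%SET ->
    b \notin labels y -> labels z = (b |: labels y)%SET ->
  y = (x `|` (c a.+1 `&` z))%O /\
  exists2 y', (x < y' < z)%O & labels y' = (b |: labels x)%SET.
Proof.
move=> cxy cyz ab ax yE by_ zE; have [[xy _] [yz _]] := (cxy, cyz).
have bx : b \notin labels x by apply: contra by_; rewrite yE !inE => ->; rewrite orbT.
have H w : (x < w < z)%O -> b \notin labels w -> w = (x `|` (c a.+1 `&` z))%O.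
  move=> /andP[xw wz] bw.
  have [D [frD xD wD zD]] := frame3 (ltW xw) (ltW wz).
  have aD : c a.+1 \in D by have [_ _] := frD; apply.
  apply: (labels_inj c0 cn c_covers frD) => //.
    by rewrite (frame_join frD) ?(frame_meet frD).
  rewrite labels_between ?ltn_ord ?(ltW (lt_trans xw wz)) //.
  apply/eqP; rewrite finset.eqEsubset; apply/andP; split; last first.
    rewrite finset.subUset labels_homo ?(ltW xw) //=.
    have /properP[_ [d dw dx]] := labels_proper xw.
    have := fintype.subsetP (labels_homo (ltW wz)) d dw.
    rewrite zE yE finset.in_setU1 => /predU1P[dE|]; first by rewrite dE (negbTE bw) in dw.
    rewrite finset.in_setU1 (negbTE dx) orbF => /eqP dE.
    apply/fintype.subsetP => i; rewrite finset.in_setI finset.in_setU1 finset.in_setU1.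
    rewrite inE => /andP[ia]; case/or3P => [/eqP iE|/eqP->|ix].
    - by move: ia; rewrite iE ltnS leqNgt ab.
    - by rewrite -dE.
    - exact: (fintype.subsetP (labels_homo (ltW xw))).
  apply/fintype.subsetP => i iw; have := fintype.subsetP (labels_homo (ltW wz)) i iw.
  rewrite finset.in_setU finset.in_setI zE yE !finset.in_setU1.
  case/or3P => [/eqP iE|/eqP->|->//]; first by rewrite iE (negbTE bw) in iw.
  by rewrite eqxx orbT andbT !inE ltnSn orbT.
have yE' := H y; rewrite xy yz by_ in yE'; have {}yE' := yE' isT isT.
split=> //; have [y' xyz yy] := rank2_interval cxy cyz.
exists y' => //; have [xy' yz'] := andP xyz.
have bY : b \in labels y'.
  by apply: contraNT yy => bw; rewrite yE' -(H y').
have aY : a \notin labels y'.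
  have /properP[_ [d dz]] := labels_proper yz'; apply: contra => aY.
  move: dz; rewrite zE yE !finset.in_setU1 => /or3P[/eqP->|/eqP->|] //.
  exact: (fintype.subsetP (labels_homo (ltW xy'))).
apply/eqP; rewrite finset.eqEsubset finset.subUset labels_homo ?(ltW xy') // andbT finset.sub1set bY andbT.
apply/fintype.subsetP => i iy; have := fintype.subsetP (labels_homo (ltW yz')) i iy.
rewrite zE yE !finset.in_setU1 => /or3P[->|/eqP iE|->] //; rewrite ?orbT //.
by rewrite iE (negbTE aY) in iy.
Qed.

(** Among the maximal chains whose frame contains [d], one with the largest frame is chosen. Its
    labels descend, and such a chain together with the prefixes separates all pairs of labels. *)
Lemma boolean_frame_cover d : chain (mem d) ->
  exists D, [/\ distributive_frame n c D, d \subset D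
              & forall S, exists2 u, u \in D & labels u = S].
Proof.
move=> chd; have [f0 maxf0 df0] := maximal_chain_exists chd.
pose P f := `[< maximal_chain f >] && (d \subset frame f).
have Pf0 : P f0.
  apply/andP; split; first exact/asboolP.
  by apply/fintype.subsetP => x /(fintype.subsetP df0)/mem_frame.
case: (@arg_maxnP _ f0 P (fun f => #|frame f|) Pf0) => f /andP[/asboolP maxf df] f_max.
have [chf _] := maxf; have frD := frame_distributive chf.
have [m [e [e0 em e_cov fP]]] := maximal_chain_enum maxf.
have ef k : (k <= m)%N -> e k \in frame f.
  by move=> km; apply: mem_frame; apply/fP; exists k.
(* An ascent at [e k.+1] would contradict the choice of [f]: trading this element for the [y'] of
   [ascent_swap] strictly enlarges the frame. *)
have descent k a b : (k.+1 < m)%N ->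
    a \notin labels (e k) -> labels (e k.+1) = (a |: labels (e k))%SET ->
    b \notin labels (e k.+1) -> labels (e k.+2) = (b |: labels (e k.+1))%SET ->
  (b < a)%N.
  move=> km ax yE by_ zE; rewrite ltn_neqAle leqNgt.
  have -> /= : b != a :> nat.
    by apply: contra by_ => /eqP/val_inj ->; rewrite yE finset.setU11.
  apply/negP => ab; have covk := e_cov _ (ltnW km); have covk1 := e_cov _ km.
  have [yE' [y' /andP[xy' yz'] y'E]] := ascent_swap covk covk1 ab ax yE by_ zE.
  pose x := e k; pose y := e k.+1; pose z := e k.+2.
  have xf : x \in f by apply/fP; exists k; rewrite // ltnW // ltnW.
  have zf : z \in f by apply/fP; exists k.+2.
  have yf : y \in f by apply/fP; exists k.+1; rewrite // ltnW.
  have cmp w : w \in f -> w != y -> (w <= x)%O \/ (z <= w)%O.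
    move=> wf wy; have /orP[wle|wge] := chf _ _ wf yf.
      have /orP[->|xw] := chf _ _ wf xf; [by left|left].
      have [-> //|wx] := eqVneq w x.
      by case: covk => _ /(_ w)[]; rewrite !lt_neqAle eq_sym wx xw wy wle.
    have /orP[wz|->] := chf _ _ wf zf; [right|by right].
    have [-> //|wx] := eqVneq w z.
    by case: covk1 => _ /(_ w)[]; rewrite !lt_neqAle eq_sym wy wge wx wz.
  pose f' := (y' |: (f :\ y))%SET.
  have chf' : chain (mem f').
    have cmp' w : w \in (f :\ y)%SET -> (w >=< y')%O.
      rewrite !inE => /andP[wy wf]; have [wx|zw] := cmp w wf wy.
        by rewrite /Order.comparable (le_trans wx (ltW xy')).
      by rewrite /Order.comparable (le_trans (ltW yz') zw) orbT.
    move=> w1 w2; rewrite !finset.in_setU1 => /predU1P[->|w1f] /predU1P[->|w2f].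
    - exact: comparablexx.
    - by rewrite comparable_sym cmp'.
    - exact: cmp'.
    - by move: w1f w2f; rewrite !inE => /andP[_ ?] /andP[_ ?]; apply: chf.
  have sxyz w : w \in f -> w != y -> w \in frame f'.
    by move=> wf wy; apply: mem_frame; rewrite !inE wy wf orbT.
  have frD' := frame_distributive chf'.
  (* The discarded [y] is not lost: it is a lattice expression in its two neighbours and
     [c a.+1]. *)
  have yD' : y \in frame f'.
    rewrite /y yE' (frame_join frD') ?(frame_meet frD') //.
    - by apply: sxyz; rewrite // lt_eqF // covk.1.
    - by have [_ _] := frD'; apply.
    - by apply: sxyz; rewrite // gt_eqF // covk1.1.
  have sub : frame f \subset frame f'.
    apply: sublattice_generated_min; first exact: sublattice_generated_sublattice.
    rewrite finset.subUset; apply/andP; split.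
      by apply: fintype.subset_trans (sub_sublattice_generated _); exact: finset.subsetUl.
    apply/fintype.subsetP => w wf; have [->//|] := eqVneq w y; exact: sxyz.
  have [f'' maxf'' f'f''] := maximal_chain_exists chf'.
  have sub' : frame f' \subset frame f''.
    apply: sublattice_generated_min; first exact: sublattice_generated_sublattice.
    apply: fintype.subset_trans (sub_sublattice_generated _).
    exact: finset.setUS.
  have /f_max : P f''.
    apply/andP; split; first exact/asboolP.
    exact: fintype.subset_trans df (fintype.subset_trans sub sub').
  rewrite /= leqNgt => /negP; apply; apply: proper_card.
  apply: fintype.proper_sub_trans sub'; rewrite properE sub; apply/negP => /fintype.subsetP.
  move=> /(_ y'); rewrite mem_frame ?finset.setU11 // => /(_ isT) y'D.
  (* On the frame of [f], the label [b] never occurs without [a]. *)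
  pose E := [set u in frame f | (b \in labels u) ==> (a \in labels u)]%SET.
  have : y' \in E.
    apply: (fintype.subsetP (sublattice_generated_min (S := E) _ _) y' y'D).
      apply/sublatticeP => u v; rewrite !inE => /andP[uD] uab /andP[vD] vab.
      rewrite (frame_meet frD) // (frame_join frD) //=.
      have := labels_meet c_covers frD uD vD; move/setP => LM.
      have := labels_join c_covers frD uD vD; move/setP => LJ.
      have := (LM a, LM b, LJ a, LJ b); rewrite !inE => -[[[-> ->] ->] ->].
      by move: uab vab; case: (a \in labels u); case: (a \in labels v); case: (b \in labels u); case: (b \in labels v).
    apply/fintype.subsetP => w; rewrite finset.in_setU => /orP[/CP[j jn ->]|wf].
      rewrite inE; have [_ _ -> //] := frD; rewrite labels_c // !inE /=.
      by apply/implyP; apply: ltn_trans.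
    rewrite finset.in_set mem_frame //=; have [->|wy] := eqVneq w y.
      by rewrite /y yE finset.setU11 implybT.
    apply/implyP => bw; have [wx|zw] := cmp w wf wy.
      case/negP: by_; apply: fintype.subsetP (labels_homo _) _ bw.
      exact: le_trans wx (ltW covk.1).
    apply: (fintype.subsetP (labels_homo zw)).
    by rewrite zE yE !inE eqxx orbT.
  rewrite finset.in_set y'D y'E finset.setU11 /= finset.in_setU1 (negbTE ax) orbF.
  by move=> /eqP aE; rewrite aE ltnn in ab.
(* Chaining the descents: a label entering at step [j] is smaller than every label already
   present. *)
have desc j b : (j < m)%N -> b \notin labels (e j) ->
    labels (e j.+1) = (b |: labels (e j))%SET ->
  forall a, a \in labels (e j) -> (b < a)%N.
  elim: j b => [|j IHj] b jm bj bE a; first by rewrite e0 labels_bot // finset.in_set0.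
  have [a' a'j a'E] := labels_covers (e_cov _ (ltnW jm)).
  have ba := descent _ _ _ jm a'j a'E bj bE.
  rewrite {1}a'E finset.in_setU1 => /predU1P[->//|/(IHj a' (ltnW jm) a'j a'E)].
  exact: ltn_trans.
exists (frame f); split=> // S.
suff: S \in [pred S | [exists u in frame f, labels u == S]].
  by rewrite inE => /exists_inP[u uD /eqP uS]; exists u.
have memF u : u \in frame f ->
    labels u \in [pred S | [exists u in frame f, labels u == S]].
  by move=> uD; rewrite inE; apply/exists_inP; exists u.
apply: separating_family.
- by rewrite -(labels_bot c_covers) -e0; apply: memF; apply: ef.
- by rewrite -(labels_top n c) -em; apply: memF; apply: ef.
- move=> A B; rewrite !inE => /exists_inP[u uD /eqP<-] /exists_inP[v vD /eqP<-].
  by rewrite -(labels_join c_covers frD) //; apply: (memF); apply: (frame_join frD).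
- move=> A B; rewrite !inE => /exists_inP[u uD /eqP<-] /exists_inP[v vD /eqP<-].
  by rewrite -(labels_meet c_covers frD) //; apply: (memF); apply: (frame_meet frD).
move=> b a bS aS; have ab : a != b by apply: contraNneq aS => ->.
have [ba|ab'] := ltnP b a.
  exists (labels (c b.+1)); split.
  - by apply: memF; have [_ _] := frD; apply.
  - by rewrite labels_c // inE ltnSn.
  - by rewrite labels_c // inE -leqNgt.
(* Large labels enter first, so [a] is still missing from the first [e j] that contains [b]. *)
have {ab'} ab' : (a < b)%N by rewrite ltn_neqAle ab' andbT.
have exj : exists j, b \in labels (e j).
  by exists m; rewrite em labels_top finset.in_setT.
case: (ex_minnP exj) => j bj j_min; case: j bj j_min => [|j] bj j_min.
  by rewrite e0 labels_bot // finset.in_set0 in bj.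
have jm : (j < m)%N by apply: j_min; rewrite em labels_top finset.in_setT.
have bj' : b \notin labels (e j) by apply/negP => /j_min; rewrite ltnn.
exists (labels (e j.+1)); split=> //; first exact/memF/ef.
have [a' a'j a'E] := labels_covers (e_cov _ jm).
move: bj; rewrite a'E finset.in_setU1 (negbTE bj') orbF => /eqP bE.
rewrite -bE in a'j a'E *; rewrite finset.in_setU1 (negbTE ab) /=.
by apply/negP => /(desc j b jm a'j a'E); rewrite ltnNge ltnW.
Qed.

End BooleanFrames.

(** * Flags of subsets and the weak order *)

Section HeightPermutations.
Variable n : nat.
Implicit Types (s t : {perm 'I_n}) (S T : {set 'I_n}) (i j a b : 'I_n).

(* A permutation is read as a height function: its upsets form a complete flag
   of subsets, and [s] lies below [t] in the weak order when [s b < s a] implies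
   [t b < t a] for all [b < a]. *)
Definition upset s S : bool :=
  [forall a, forall b, (a \in S) ==> (b \notin S) ==> (s b < s a)%N].

Definition level s k : {set 'I_n} := [set i | (k <= s i)%N]%SET.

Lemma upsetP s S :
  reflect (forall a b, a \in S -> b \notin S -> (s b < s a)%N) (upset s S).
Proof.
apply: (iffP forallP) => [H a b aS bS|H a]; first by have /forallP/(_ b) := H a; rewrite aS bS.
by apply/forallP => b; apply/implyP => aS; apply/implyP => bS; apply: H.
Qed.

Lemma upset_level s k : upset s (level s k).
Proof. by apply/upsetP => a b; rewrite !inE -ltnNge => /[swap]; exact: leq_trans. Qed.

Lemma upset_comparable s S T :
  upset s S -> upset s T -> (S \subset T) || (T \subset S).
Proof.
move=> /upsetP uS /upsetP uT; have [//|/fintype.subsetPn[a aS aT]] := boolP (S \subset T).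
apply/fintype.subsetP => b bT; apply: contraT => bS.
by have := ltn_trans (uS a b aS bS) (uT b a bT aT); rewrite ltnn.
Qed.

Lemma upset_min s S a :
  a \in S -> (forall b, b \in S -> (s a <= s b)%N) -> upset s S ->
  S = level s (s a).
Proof.
move=> aS amin /upsetP uS; apply/setP => b; rewrite inE.
apply/idP/idP => [/amin //|ab]; apply: contraT => bS.
by have := uS a b aS bS; rewrite ltnNge ab.
Qed.

Lemma upset_neq0 s S : upset s S -> S != finset.set0 ->
  exists2 a, a \in S & S = level s (s a).
Proof.
move=> uS /finset.set0Pn[a0 a0S].
case: (@arg_minnP _ a0 (fun a => a \in S) (fun a => val (s a)) a0S) => a aS amin.
by exists a => //; apply: upset_min.
Qed.

(** A height is the number of elements below it, and by injectivity an implication between two total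
    orders is an equivalence. *)
Lemma perm_homo_eq s t :
  (forall a b, (s a < s b)%N -> (t a < t b)%N) -> t = s.
Proof.
have card_lt (r : {perm 'I_n}) i : #|[set j | (r j < r i)%N]%SET| = r i.
  transitivity #|r @^-1: [set k : 'I_n | (k < r i)%N]%SET|.
    by apply: eq_card => j; rewrite !inE.
  rewrite card_preimset; last exact: perm_inj.
  rewrite -sum1dep_card -(big_ord_widen n (fun=> 1%N)) ?sum1_card ?card_ord //.
  exact: ltnW (ltn_ord _).
move=> st; apply/perm.permP => i; apply/val_inj; rewrite /= -(card_lt t i) -(card_lt s i).
apply: eq_card => j; rewrite !inE; apply/idP/idP => [|/st //].
have [//|ij|/val_inj/perm_inj ->] := ltngtP (s j) (s i); last by rewrite ltnn.
by move/ltn_trans => /(_ _ (st _ _ ij)); rewrite ltnn.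
Qed.

Lemma perm_of_order (lt : rel 'I_n) :
  irreflexive lt -> transitive lt -> (forall i j, i != j -> lt i j || lt j i) ->
  exists s, forall i j, (s i < s j)%N = lt i j.
Proof.
move=> irr tr tot; pose h i := #|[pred j | lt j i]|.
have h_lt i j : lt i j -> (h i < h j)%N.
  move=> ij; apply: proper_card; apply/properP; split.
    by apply/fintype.subsetP => k; rewrite !inE => /tr; apply.
  by exists i; rewrite !inE ?irr.
have h_n i : (h i < n)%N.
  rewrite -[X in (_ < X)%N]card_ord; apply: proper_card; apply/properP; split.
    exact/fintype.subsetP.
  by exists i; rewrite // !inE irr.
have h_ltE i j : (h i < h j)%N = lt i j.
  apply/idP/idP => [hij|/h_lt//].
  have [ij|/tot/orP[//|/h_lt]] := eqVneq i j; first by rewrite ij ltnn in hij.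
  by move/ltn_trans => /(_ _ hij); rewrite ltnn.
have inj : injective (fun i => Ordinal (h_n i)).
  move=> i j [hij]; apply/eqP; apply: contraT => /tot.
  by rewrite -!h_ltE hij ltnn.
by exists (perm inj) => i j; rewrite !permE /=.
Qed.

(** A point on a wall lies in several closed chambers and [r] chooses among them: the natural order
    picks the highest one in the weak order, the reversed order the lowest. *)
Lemma chamber d (O : orderType d) (x : 'I_n -> O) (r : 'I_n -> nat) :
  injective r ->
  exists s, forall i j,
    (s i < s j)%N = (x i < x j)%O || (x i == x j) && (r i < r j)%N.
Proof.
move=> r_inj.
apply: (@perm_of_order (fun i j => (x i < x j)%O || (x i == x j) && (r i < r j)%N)).
- by move=> i; rewrite ltxx ltnn andbF.
- move=> j i k /orP[ij|/andP[/eqP-> ij]] /orP[jk|/andP[/eqP<- jk]].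
  + by rewrite (lt_trans ij jk).
  + by rewrite ij.
  + by rewrite jk.
  + by rewrite eqxx (ltn_trans ij jk) orbT.
- move=> i j ij; case: ltgtP => //= _.
  by case: ltngtP => // /r_inj E; rewrite E eqxx in ij.
Qed.

(* Counting the members of a chain of sets that contain a given point gives a
   height function whose upsets include the chain. *)
Lemma chain_chamber (tau : {set {set 'I_n}}) (r : 'I_n -> nat) :
    injective r -> {in tau &, forall S T, (S \subset T) || (T \subset S)} ->
  exists s, {in tau, forall S, upset s S} /\
    forall i j, (s i < s j)%N ->
      (exists2 S, S \in tau & (j \in S) && (i \notin S)) \/ (r i < r j)%N.
Proof.
move=> r_inj ch; pose x i := #|[set S in tau | i \in S]%SET|.
have x_lt S i j : S \in tau -> i \in S -> j \notin S -> (x j < x i)%N.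
  move=> St iS jS; apply: proper_card; apply/properP; split.
    apply/fintype.subsetP => T; rewrite !inE => /andP[Tt jT]; rewrite Tt /=.
    have /orP[/fintype.subsetP|/fintype.subsetP/(_ _ jT)] := ch S T St Tt; first exact.
    by rewrite (negbTE jS).
  by exists S; rewrite !inE St.
have [s sP] := @chamber _ nat x r r_inj; exists s; split=> [S St|i j].
  by apply/upsetP => a b aS bS; rewrite sP ltEnat /= (x_lt S).
rewrite sP => /orP[|/andP[_ ?]]; last by right.
rewrite ltEnat /= ltnNge => xij; left.
have /fintype.subsetPn[S] : ~~ ([set S in tau | j \in S]%SET \subset [set S in tau | i \in S]%SET).
  by apply: contra xij; exact: subset_leq_card.
by rewrite !inE => /andP[St jS]; rewrite St /= => iS; exists S; rewrite ?jS.
Qed.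

Section AdjacentSwap.
Variables (s : {perm 'I_n}) (a b : 'I_n).
Hypothesis ab : s b = (s a).+1 :> nat.

(** The chamber on the other side of the wall obtained by dropping [level s (s b)] from the flag of
    [s]. *)
Definition adjacent_swap := (tperm a b * s)%g.

Let neq_ab : a != b.
Proof. by apply: contra_eqN ab => /eqP->; rewrite ltn_eqF. Qed.

Lemma upset_adjacent S : upset s S -> S != level s (s b) -> (a \in S) = (b \in S).
Proof.
move=> uS SN; have /upsetP uS' := uS.
apply/idP/idP => [aS|bS]; apply: contraT => nS.
  by have := uS' a b aS nS; rewrite ab ltnNge leqnSn.
case/eqP: SN; apply: upset_min => // i iS.
by rewrite ab; apply: uS'.
Qed.

Lemma upset_adjacent_swap S : upset s S -> S != level s (s b) ->
  upset adjacent_swap S.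
Proof.
move=> uS SN; have /upsetP uS' := uS.
have abS := upset_adjacent uS SN.
have tS i : (tperm a b i \in S) = (i \in S) by case: tpermP => [->|->|].
by apply/upsetP => i j iS jS; rewrite !permM uS' ?tS.
Qed.

Lemma adjacent_swapN : ~~ upset adjacent_swap (level s (s b)).
Proof.
apply/upsetP => /(_ b a); rewrite !inE leqnn !permM tpermL tpermR ab ltnn.
by move=> /(_ isT isT); rewrite ltnNge leqnSn.
Qed.

Lemma level_adjacent_swap (i j : 'I_n) : (s i < s j)%N -> (i, j) <> (a, b) ->
  exists S, [/\ upset s S, S != level s (s b), j \in S & i \notin S].
Proof.
move=> ij Nab; have [jb|jb] := eqVneq j b; last first.
  exists (level s (s j)); rewrite upset_level !inE leqnn -ltnNge; split=> //.
  apply: contra jb => /eqP/setP E; have := (E j, E b); rewrite !inE !leqnn.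
  move=> [/esym bj jb]; apply/eqP/(perm_inj (s := s))/val_inj/eqP.
  by rewrite /= eqn_leq bj jb.
exists (level s (s a)); rewrite upset_level !inE -ltnNge; split=> //.
- by apply/eqP => /setP/(_ a); rewrite !inE leqnn ab ltnn.
- by rewrite jb ab leqnSn.
rewrite ltn_neqAle -ltnS -ab -jb ij andbT; apply/negP => /eqP/val_inj/perm_inj ia.
by apply: Nab; rewrite ia jb.
Qed.

(** Thinness of the Coxeter complex: the remaining levels still fix the order of every pair except
    [a], [b], and the two possible orders of this pair give the two flags. *)
Lemma adjacent_swap_unique t :
    (forall S, upset s S -> S != level s (s b) -> upset t S) ->
  t = s \/ t = adjacent_swap.
Proof.
move=> st.
have lt_t i j : (s i < s j)%N -> (i, j) <> (a, b) -> (t i < t j)%N.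
  move=> ij Nij; have [S [uS SN jS iS]] := level_adjacent_swap ij Nij.
  by have /upsetP := st S uS SN; apply.
have [tab|tba] := ltnP (t a) (t b); [left|right]; apply: perm_homo_eq => i j.
  have [[-> ->] //|Nij] := eqVneq (i, j) (a, b).
  by move=> /lt_t; apply; exact/eqP.
have {}tba : (t b < t a)%N.
  by rewrite ltn_neqAle tba andbT; apply: contra neq_ab => /eqP/val_inj/perm_inj ->.
have s_neq k l : k != l -> (s k : nat) != s l.
  by apply: contra => /eqP/val_inj/perm_inj ->.
rewrite !permM.
case: (tpermP a b i) => [->|->|/eqP ia /eqP ib];
  case: (tpermP a b j) => [->|->|/eqP ja /eqP jb]; rewrite ?ltnn ?ab //.
- by rewrite ltnNge leqnSn.
- move=> h; apply: lt_t; first exact: ltnW.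
  by case=> jb'; rewrite jb' eqxx in jb.
- move=> h; apply: lt_t; last by case=> ba; move: neq_ab; rewrite ba eqxx.
  by rewrite ab ltn_neqAle h andbT -ab s_neq // eq_sym.
- rewrite ltnS => h; apply: lt_t; last by case=> _ ab'; move: neq_ab; rewrite ab' eqxx.
  by rewrite ltn_neqAle h s_neq.
- move=> h; apply: lt_t; last by case=> ia'; rewrite ia' eqxx in ia.
  by rewrite ab; apply: leqW.
- by move=> h; apply: lt_t => //; case=> ia'; rewrite ia' eqxx in ia.
Qed.

End AdjacentSwap.

(** The gallery distance between two chambers, counted as the number of walls that separate them. *)
Definition disagreements s t : nat :=
  #|[set p : 'I_n * 'I_n | (s p.1 < s p.2)%N && (t p.2 < t p.1)%N]%SET|.

(** If [t] respected all pairs of consecutive heights of [s], it would respect all pairs by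
    transitivity. *)
Lemma disagreement_exists s t : s != t ->
  exists a b, s b = (s a).+1 :> nat /\ (t b < t a)%N.
Proof.
move=> st; apply/not_existsP => noab; case/eqP: st; apply/esym/perm_homo_eq.
have step a b : s b = (s a).+1 :> nat -> (t a < t b)%N.
  move=> ab; have [//|ba|/val_inj/perm_inj E] := ltngtP (t a) (t b).
    by case: (noab a); exists b.
  by move: ab; rewrite E => /eqP; rewrite ltn_eqF.
move=> a b; move: {2}(s b - s a)%N (erefl (s b - s a)%N) => d.
elim: d b => [|d IHd] b.
  by move/eqP; rewrite subn_eq0 leqNgt => /negbTE->.
move=> dE ab; have sb0 : (0 < s b)%N by apply: leq_ltn_trans ab.
have pb : ((s b).-1 < n)%N by apply: leq_ltn_trans (ltn_ord (s b)); exact: leq_pred.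
pose b' := (s^-1)%g (Ordinal pb).
have sb' : s b' = (s b).-1 :> nat by rewrite /b' permKV.
have b'b : (t b' < t b)%N by apply: step; rewrite sb' prednK.
have [->//|b'a] := eqVneq a b'.
apply: ltn_trans b'b; apply: IHd.
  by rewrite sb' -subn1 subnAC dE subn1.
rewrite ltn_neqAle; apply/andP; split; last by rewrite sb' -ltnS prednK.
by apply: contra b'a => /eqP/val_inj/perm_inj ->.
Qed.

Lemma disagreements_swap s t a b : s b = (s a).+1 :> nat -> (t b < t a)%N ->
  (disagreements (adjacent_swap s a b) t < disagreements s t)%N.
Proof.
move=> ab tba; apply: proper_card; apply/properP; split; last first.
  exists (a, b); rewrite /adjacent_swap !inE /= ?permM ?tpermL ?tpermR tba andbT ab.
    exact: ltnSn.
  by rewrite -leqNgt leqnSn.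
apply/fintype.subsetP => -[i j]; rewrite /adjacent_swap !inE /= !permM => /andP[+ tij].
rewrite tij andbT.
have s_neq k l : k != l -> (s k : nat) != s l.
  by apply: contra => /eqP/val_inj/perm_inj ->.
case: (tpermP a b i) => [ia|ib|/eqP ia /eqP ib];
  case: (tpermP a b j) => [ja|jb|/eqP ja /eqP jb]; rewrite ?ia ?ib ?ja ?jb ?ltnn ?ab //.
- exact: ltnW.
- by rewrite ib ja ltnNge ltnW in tij.
- by move=> h; rewrite ltn_neqAle h andbT -ab s_neq // eq_sym.
- by rewrite ltnS => h; rewrite ltn_neqAle h s_neq.
- exact: leqW.
Qed.

End HeightPermutations.

Definition proper_subset n (S : {set 'I_n}) : bool :=
  (S != finset.set0) && (S != finset.setT).

Section Levels.
Variables (n : nat) (s : {perm 'I_n}).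

Lemma level_proper k : (0 < k < n)%N -> proper_subset (level s k).
Proof.
move=> /andP[k0 kn]; have n0 := leq_ltn_trans (leq0n k) kn.
apply/andP; split.
  by apply/finset.set0Pn; exists ((s^-1)%g (Ordinal kn)); rewrite inE permKV.
apply/eqP => /setP/(_ ((s^-1)%g (Ordinal n0))).
by rewrite !inE permKV /= leqNgt k0.
Qed.

Lemma proper_upset_level S : upset s S -> proper_subset S ->
  exists2 k, (0 < k < n)%N & S = level s k.
Proof.
move=> uS /andP[S0 S1]; have [a aS SE] := upset_neq0 uS S0.
exists (s a) => //; rewrite ltn_ord andbT lt0n; apply: contra S1 => /eqP a0.
by rewrite SE a0; apply/eqP/setP => b; rewrite !inE.
Qed.

Lemma level_inj k l : (k < n)%N -> (l < n)%N -> level s k = level s l -> k = l.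
Proof.
move=> kn ln /setP E; apply/eqP; rewrite eqn_leq.
have := E ((s^-1)%g (Ordinal kn)); rewrite !inE permKV /= leqnn => <-.
by have := E ((s^-1)%g (Ordinal ln)); rewrite !inE permKV /= leqnn => ->.
Qed.

Lemma level_pair k : (0 < k < n)%N ->
  exists a b, s b = k :> nat /\ s b = (s a).+1 :> nat.
Proof.
move=> /andP[k0 kn]; have pk : (k.-1 < n)%N by apply: leq_ltn_trans kn; exact: leq_pred.
exists ((s^-1)%g (Ordinal pk)), ((s^-1)%g (Ordinal kn)).
by rewrite !permKV /= prednK.
Qed.

End Levels.

(** * The ears and their boundaries *)

Section Ears.
Variables (disp : Order.disp_t) (L : finTBLatticeType disp).
Variables (n : nat) (c : nat -> L) (N : nat) (D : 'I_N.+1 -> {set L}).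
Hypotheses (c0 : c 0%N = \bot%O) (cn : c n = \top%O).
Hypothesis c_covers : forall k, (k < n)%N -> covers (c k) (c k.+1).
Hypothesis D_frame : forall i, distributive_frame n c (D i).
Hypothesis D_onto : forall i S, exists2 u, u \in D i & labels n c u = S.
Hypothesis D_inj : injective D.
Hypothesis D_cover : forall d : {set L}, chain (mem d) -> exists i, d \subset D i.
Implicit Types (i j : 'I_N.+1) (s : {perm 'I_n}) (t : {fset L}) (u v : L) (S T : {set 'I_n}).

Local Notation labels := (labels n c).
Local Notation prefix := (prefix n).

Definition elt i S : L := odflt \bot%O [pick u in D i | labels u == S].

Lemma eltP i S : elt i S \in D i /\ labels (elt i S) = S.
Proof.
rewrite /elt; case: pickP => [u /andP[? /eqP] //|no].
by have [u uD uS] := D_onto i S; have := no u; rewrite uD uS eqxx.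
Qed.

Lemma labels_inj_on i : {in D i &, injective labels}.
Proof. exact: (labels_inj c0 cn c_covers (D_frame i)). Qed.

Lemma labelsK i : {in D i, cancel labels (elt i)}.
Proof. by move=> v vD; have [? ?] := eltP i (labels v); apply: (@labels_inj_on i). Qed.

Lemma proper_labels i v : v \in D i ->
  (v \in @proper_part _ L) = proper_subset (labels v).
Proof.
move=> vD; have [_ _ cD] := D_frame i.
have botD : \bot%O \in D i by rewrite -c0 cD.
have topD : \top%O \in D i by rewrite -cn cD.
rewrite inE /proper_subset -(labels_bot c_covers) -(labels_top n c).
congr (~~ _ && ~~ _); apply/eqP/eqP => [->//|].
  exact: (labels_inj_on vD botD).
exact: (labels_inj_on vD topD).
Qed.

(** Levels [1] to [n.-1] only: level [0] is the full set and the levels from [n] on are empty. *)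
Definition flag i s : {fset L} :=
  [fset elt i (level s k.+1) | k : 'I_n.-1 in 'I_n.-1]%fset.

Lemma in_flag i s v :
  (v \in flag i s) = [&& v \in D i, v \in @proper_part _ L & upset s (labels v)].
Proof.
apply/imfsetP/and3P => [[k /= _ ->]|[vD vP uv]].
  have [eD eE] := eltP i (level s k.+1); rewrite (proper_labels eD) eE eD upset_level.
  by rewrite level_proper //= -ltn_predRL.
move: vP; rewrite (proper_labels vD) => vP.
have [k /andP[k0 kn] kE] := proper_upset_level uv vP.
have kn' : (k.-1 < n.-1)%N by rewrite ltn_predRL prednK.
by exists (Ordinal kn') => //; rewrite /= prednK // -kE labelsK.
Qed.

Lemma card_flag i s : #|` flag i s| = n.-1.
Proof.
rewrite card_imfset /= ?size_enum_ord //.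
move=> k l /(congr1 labels); rewrite !(eltP i _).2 => /level_inj E.
by apply/val_inj/eqP; rewrite -eqSS; apply/eqP/E; rewrite -ltn_predRL.
Qed.

(* The facets of the [i]-th ear are the flags of [D i] which are not contained
   in any earlier [D j]. *)
Definition new i s : bool :=
  ~~ [exists j : 'I_N.+1, (j < i)%N &&
      [forall v in D i, upset s (labels v) ==> (v \in D j)]].

Definition ear i : set {fset L} :=
  [set t | exists2 s, new i s & fsubset t (flag i s)]%classic.

Lemma newPn i s : reflect
  (exists2 j : 'I_N.+1, (j < i)%N &
     forall v, v \in D i -> upset s (labels v) -> v \in D j)
  (~~ new i s).
Proof.
rewrite negbK; apply: (iffP existsP) => [[j /andP[ji /forall_inP H]]|[j ji H]].
  by exists j => // v vD uv; have := H v vD; rewrite uv.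
exists j; rewrite ji; apply/forall_inP => v vD; apply/implyP; exact: H.
Qed.

(* [D j] absorbs an element of [D i] as soon as the labels of this element can
   be separated by elements of both, prefixes being always available. *)
Lemma absorb i j v : v \in D i ->
    (forall a b, a \in labels v -> b \notin labels v -> (b < a)%N ->
       exists u, [/\ u \in D i, u \in D j, a \in labels u & b \notin labels u]) ->
  v \in D j.
Proof.
move=> vD sep; pose F := [pred S | elt i S \in D j].
have [[_ _ ciD] [_ _ cjD]] := (D_frame i, D_frame j).
have memF u : u \in D i -> (labels u \in F) = (u \in D j) by move=> uD; rewrite inE labelsK.
have prefixF k : (k <= n)%N -> prefix k \in F.
  by move=> kn; rewrite -(labels_c c_covers kn) memF ?ciD ?cjD.
rewrite -memF //; apply: separating_family.
- have -> : finset.set0 = prefix 0 by apply/setP => a; rewrite !inE.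
  exact: prefixF.
- have -> : finset.setT = prefix n by apply/setP => a; rewrite !inE ltn_ord.
  exact: prefixF.
- move=> A B; rewrite !inE => AD BD; have [[A1 <-] [B1 <-]] := (eltP i A, eltP i B).
  rewrite -(labels_join c_covers (D_frame i)) // labelsK ?(frame_join (D_frame i)) //.
  exact: (frame_join (D_frame j)).
- move=> A B; rewrite !inE => AD BD; have [[A1 <-] [B1 <-]] := (eltP i A, eltP i B).
  rewrite -(labels_meet c_covers (D_frame i)) // labelsK ?(frame_meet (D_frame i)) //.
  exact: (frame_meet (D_frame j)).
move=> a b av bv; have [|ba] := leqP a b.
  rewrite leq_eqVlt => /predU1P[/val_inj ab|ab]; first by rewrite -ab av in bv.
  by exists (prefix a.+1); rewrite !inE ltnSn -leqNgt ab; split=> //; exact: prefixF.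
by have [u [uDi uDj au bu]] := sep a b av bv ba; exists (labels u); rewrite memF.
Qed.

(** If the flag of [t] lies in [D j], its levels separate all pairs [b < a] that [s] puts in this
    order, so [D j] absorbs the flag of [s] too. *)
Lemma new_upward i s (t : {perm 'I_n}) : new i s ->
  (forall a b : 'I_n, (b < a)%N -> (s b < s a)%N -> (t b < t a)%N) -> new i t.
Proof.
move=> + st; apply: contraLR => /newPn[j ji jt]; apply/newPn; exists j => // v vD.
move=> /upsetP uv; apply: (absorb vD) => a b av bv ba.
have tba : (t b < t a)%N by apply: st => //; exact: uv.
have [eD eE] := eltP i (level t (t a)); exists (elt i (level t (t a))).
by rewrite eE !inE leqnn -ltnNge; split=> //; apply: jt => //; rewrite eE upset_level.
Qed.

Lemma new_first s : new ord0 s.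
Proof. by apply/negP => /existsP[j]; rewrite ltn0. Qed.

(** The identity is the top of the weak order. Its levels separate every pair [b < a], so a [D j]
    containing its flag would absorb all of [D i] and coincide with it. *)
Lemma new_exists i : exists s, new i s.
Proof.
exists 1%g; apply: contraT => /newPn[j ji H].
suff : i = j by move=> ij; rewrite ij ltnn in ji.
have sub v : v \in D i -> v \in D j.
  move=> vD; apply: (absorb vD) => a b av bv ba.
  have [eD eE] := eltP i (level 1%g a); exists (elt i (level 1%g a)).
  rewrite eE !inE !perm1 leqnn -ltnNge; split=> //; apply: H => //.
  by rewrite eE upset_level.
apply/D_inj/setP => v; apply/idP/idP => [/sub //|vD].
have [eD eE] := eltP i (labels v).
by rewrite -(labels_inj_on (sub _ eD) vD eE).
Qed.

(** The upsets of a decreasing [s] are prefixes, that is, labels of the M-chain, which lies in every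
    frame; absorption has nothing left to separate. *)
Lemma decreasing_not_new i s : (0 < i)%N ->
  (forall a b : 'I_n, (s a < s b)%N -> (b < a)%N) -> ~~ new i s.
Proof.
move=> i0 s_decr; apply/newPn; exists ord0 => // v vD /upsetP uv.
apply: (absorb vD) => a b av bv ba; have := s_decr _ _ (uv a b av bv).
by rewrite ltnNge ltnW.
Qed.

Lemma flag_transfer i j s : (forall v, v \in flag i s -> v \in D j) ->
  flag i s = flag j s.
Proof.
move=> ij; apply/fsetP => v; rewrite [RHS]in_flag; apply/idP/and3P => [vi|].
  by split; [exact: ij|move: vi; rewrite in_flag => /and3P[] ..].
move=> [vD vP uv]; have [eD eE] := eltP i (labels v).
have ei : elt i (labels v) \in flag i s.
  by rewrite in_flag eD eE uv andbT (proper_labels eD) eE -(proper_labels vD).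
by rewrite -(labels_inj_on (ij _ ei) vD eE).
Qed.

(** The flag is new in the first frame that contains it. *)
Lemma flag_in_ear i s : exists2 j : 'I_N.+1, (j <= i)%N & ear j (flag i s).
Proof.
pose P j := `[< forall v, v \in flag i s -> v \in D j >].
have Pi : P i by apply/asboolP => v; rewrite in_flag => /and3P[].
case: (@arg_minnP _ i P val Pi) => j /asboolP Pj jmin.
exists j; first exact: jmin.
exists s; last by rewrite (flag_transfer Pj) fsubset_refl.
apply: contraT => /newPn[k kj H].
have /jmin : P k; last by rewrite leqNgt kj.
apply/asboolP => v; rewrite (flag_transfer Pj) in_flag => /and3P[vD _ uv].
exact: H.
Qed.

Lemma old_flag_in_ear i s : ~~ new i s ->
  exists2 j : 'I_N.+1, (j < i)%N & ear j (flag i s).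
Proof.
move=> /newPn[j ji H]; have [k kj eark] := flag_in_ear j s.
exists k; first exact: leq_ltn_trans kj ji.
suff -> : flag i s = flag j s by [].
by apply: flag_transfer => v; rewrite in_flag => /and3P[vD _ uv]; exact: H.
Qed.

Lemma ear_sub_frame i t : ear i t -> {subset t <= D i}.
Proof.
by move=> [s _ /fsubsetP ts] v /ts; rewrite in_flag => /and3P[].
Qed.

Lemma flag_sub_eq i s (t : {perm 'I_n}) : (forall v, v \in flag i s -> upset t (labels v)) -> t = s.
Proof.
move=> st; apply: perm_homo_eq => a b ab.
have [eD eE] := eltP i (level s (s b)).
have : upset t (level s (s b)).
  rewrite -eE; apply: st; rewrite in_flag eD (proper_labels eD) eE upset_level.
  by rewrite level_proper // ltn_ord (leq_ltn_trans _ ab).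
by move/upsetP; apply; rewrite inE // -ltnNge.
Qed.

Lemma ear_complex i : simplicial_complex (ear i).
Proof.
split=> [|t u [s new_s ts] ut]; last by exists s => //; exact: fsubset_trans ut ts.
by have [s new_s] := new_exists i; exists s => //; exact: fsub0set.
Qed.

Lemma ear_subcomplex i : subcomplex (ear i) (order_complex (@proper_part _ L)).
Proof.
split=> [|t [s _ /fsubsetP ts]]; first exact: ear_complex.
split=> [v /ts|u v /ts + /ts]; first by rewrite in_flag => /and3P[].
rewrite !in_flag => /and3P[uD _ uu] /and3P[vD _ uv].
by rewrite /Order.comparable !(labels_le c0 cn c_covers (D_frame i)) // (upset_comparable uu uv).
Qed.

Lemma chain_in_ear (t : {fset L}) : order_complex (@proper_part _ L) t ->
  exists i, ear i t.
Proof.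
move=> [tP tch].
have [i ti] : exists i, [set v | v \in t]%SET \subset D i.
  by apply: D_cover => u v; rewrite !inE; exact: tch.
have {}ti v : v \in t -> v \in D i.
  by move=> vt; apply: (fintype.subsetP ti); rewrite inE.
pose tau := [set S | elt i S \in t]%SET.
have [|s [s_up _]] := @chain_chamber n tau val val_inj.
  move=> S T; rewrite !inE => St Tt.
  have [[SD SE] [TD TE]] := (eltP i S, eltP i T).
  have := tch _ _ St Tt.
  by rewrite /Order.comparable !(labels_le c0 cn c_covers (D_frame i)) // SE TE.
have [j _ earj] := flag_in_ear i s; exists j.
apply: (ear_complex j).2 earj _; apply/fsubsetP => v vt.
rewrite in_flag ti // tP //= s_up // inE labelsK ?ti //.
Qed.

Lemma ear_cover : (\bigcup_i ear i)%classic = order_complex (@proper_part _ L).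
Proof.
apply/seteqP; split=> [t [i _ /(ear_subcomplex i).2]//|t /chain_in_ear[i earit]].
by exists i.
Qed.

Lemma ear_card_dim i : card_dim (ear i) n.-1.
Proof.
split=> [|t [s _ /fsubset_leq_card]]; last by rewrite card_flag.
have [s new_s] := new_exists i.
by exists (flag i s); [exists s => //; exact: fsubset_refl|exact: card_flag].
Qed.

Lemma order_complex_card_dim : card_dim (order_complex (@proper_part _ L)) n.-1.
Proof.
have [[t eart tn] _] := ear_card_dim ord0; split.
  by exists t => //; exact: (ear_subcomplex ord0).2.
by move=> u /chain_in_ear[i /(ear_card_dim i).2].
Qed.

Lemma order_complex_complex : simplicial_complex (order_complex (@proper_part _ L)).
Proof.
split=> [|t u [tP tch] /fsubsetP ut]; first by split=> [v|u v]; rewrite inE.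
by split=> [v /ut/tP//|v w /ut vt /ut wt]; exact: tch.
Qed.

Lemma facet_flag i s : new i s -> facet (ear i) (flag i s).
Proof.
move=> new_s; split; first by exists s => //; exact: fsubset_refl.
move=> G [t new_t Gt] sG; apply/eqP; rewrite eqEfsubset sG andbT.
suff <- : t = s by [].
apply: (@flag_sub_eq i) => v vs; have /fsubsetP/(_ v vs) := fsubset_trans sG Gt.
by rewrite in_flag => /and3P[].
Qed.

Lemma facetP i F : facet (ear i) F -> exists2 s, new i s & F = flag i s.
Proof.
move=> [[s new_s Fs] maxF]; exists s => //; apply/esym/maxF => //.
by exists s => //; exact: fsubset_refl.
Qed.

Lemma flag_swap_sub i s a b (t : {fset L}) :
    s b = (s a).+1 :> nat -> fsubset t (flag i s) ->
    (forall v, v \in t -> labels v != level s (s b)) ->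
  fsubset t (flag i (adjacent_swap s a b)).
Proof.
move=> ab /fsubsetP ts tN; apply/fsubsetP => v vt; move: (ts v vt).
rewrite !in_flag => /and3P[-> -> uv] /=.
by apply: upset_adjacent_swap => //; exact: tN.
Qed.

(** From left to right, let [s'] be the lowest flag of [D i] containing [t]. The pairs [b < a] that
    [s'] keeps in order are separated by [t], which lies in [D j], so [s'] is old. A new flag
    containing [t] and nearest to [s'] has a wall towards [s'] that contains [t]; by minimality the
    flag beyond it is old, so this wall is in the boundary. From right to left, the flag beyond a
    boundary wall cannot be new, hence lies in an earlier ear. *)
Lemma boundary_ear i :
  ((\bigcup_(j in [set j : 'I_N.+1 | (j < i)%N]) ear j) `&` ear i
    = boundary (ear i))%classic.
Proof.
apply/seteqP; split=> [t [[j /= ji tj] [s0 new_s0 ts0]]|t].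
  pose tau := [set S | elt i S \in t]%SET.
  have tauP v : v \in t -> labels v \in tau.
    by move=> vt; rewrite inE labelsK // ; move/fsubsetP/(_ v vt): ts0; rewrite in_flag => /and3P[].
  have tau_s0 S : S \in tau -> upset s0 S.
    rewrite inE => eS; move/fsubsetP/(_ _ eS): ts0.
    by rewrite in_flag (eltP i S).2 => /and3P[].
  (* Ties are broken against the natural order, which makes [s'] lowest in the weak order. *)
  pose r (k : 'I_n) := (n - k)%N.
  have r_inj : injective r.
    move=> k l; rewrite /r => E; apply/val_inj/eqP.
    by rewrite -(eqn_sub2lE (ltnW (ltn_ord k)) (ltnW (ltn_ord l))); apply/eqP.
  have [S T St Tt|s' [s'_up s'_sep]] := @chain_chamber n tau r r_inj.
    by apply: (@upset_comparable _ s0); exact: tau_s0.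
  have old_s' : ~~ new i s'.
    apply/newPn; exists j => // v vD /upsetP uv; apply: (absorb vD) => a b av bv ba.
    have [[S St /andP[aS bS]]|] := s'_sep _ _ (uv a b av bv); last first.
      by rewrite /r ltn_sub2lE ?(ltnW (ltn_ord _)) // ltnNge ltnW.
    exists (elt i S); have [eD eE] := eltP i S; rewrite eE; split=> //.
    by apply: (ear_sub_frame tj); rewrite inE in St.
  pose P s := new i s && [forall S in tau, upset s S].
  have Ps0 : P s0 by rewrite /P new_s0; apply/forall_inP.
  case: (@arg_minnP _ s0 P (fun s => disagreements s s') Ps0) => s /andP[new_s /forall_inP tau_s] smin.
  have [|a [b [ab sba]]] := @disagreement_exists n s s'.
    by apply: contraNneq old_s' => <-.
  have tauN S : S \in tau -> S != level s (s b).
    move=> St; apply/eqP => SE; have /upsetP/(_ b a) := s'_up S St.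
    by rewrite SE !inE leqnn ab ltnn => /(_ isT isT); rewrite ltnNge ltnW.
  have old_s1 : ~~ new i (adjacent_swap s a b).
    apply/negP => new_s1; have : P (adjacent_swap s a b).
      rewrite /P new_s1; apply/forall_inP => S St.
      by apply: upset_adjacent_swap; [| exact: tau_s|exact: tauN].
    by move/smin; rewrite leqNgt disagreements_swap.
  set e := elt i (level s (s b)); have [eD eE] := eltP i (level s (s b)).
  have eF : e \in flag i s.
    by rewrite in_flag eD (proper_labels eD) eE upset_level level_proper // ltn_ord ab.
  have ts : fsubset t (flag i s).
    apply/fsubsetP => v vt; have := fsubsetP ts0 v vt; rewrite !in_flag.
    by case/and3P=> -> -> _ /=; apply: tau_s; exact: tauP.
  exists (flag i s `\ e)%fset, (flag i s); split.
  - rewrite fsubsetD1 ts /=; apply/negP => et.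
    by have := tauN _ (tauP _ et); rewrite eE eqxx.
  - exact: facet_flag.
  - exact: fsubD1set.
  - by rewrite (cardfsD1 e (flag i s)) eF.
  - move=> G /facetP[s2 new_s2 ->] sub.
    have [|-> //|s2E] := @adjacent_swap_unique n s a b ab s2; last first.
      by rewrite s2E (negbTE old_s1) in new_s2.
    move=> S uS SN; have [S0|] := boolP (proper_subset S); last first.
      rewrite negb_and !negbK => /orP[]/eqP->; apply/upsetP => x y; by rewrite !inE.
    have [SD SE] := eltP i S.
    have : elt i S \in flag i s2.
      apply: (fsubsetP sub); rewrite in_fsetD1 in_flag SD (proper_labels SD) SE S0 uS !andbT.
      by apply: contra SN => /eqP/(congr1 labels); rewrite SE eE => ->.
    by rewrite in_flag SE => /and3P[].
move=> [u [F [tu /facetP[s new_s FE] uF cF uniqF]]]; rewrite {}FE in uF cF uniqF.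
have ear_s : ear i (flag i s) by exists s => //; exact: fsubset_refl.
split; last by apply: (ear_complex i).2 ear_s _; exact: fsubset_trans tu uF.
have [e eF eu] : exists2 e, e \in flag i s & e \notin u.
  apply/fsubsetPn/negP => /fsubset_leq_card; by rewrite cF ltnn.
have uE : u = (flag i s `\ e)%fset.
  apply/eqP; rewrite eqEfcard fsubsetD1 uF eu /=.
  by rewrite -ltnS -cF (cardfsD1 e (flag i s)) eF.
move: (eF); rewrite in_flag => /and3P[eD]; rewrite (proper_labels eD) => eP eU.
have [k kn eE] := proper_upset_level eU eP; have [a [b [sb ab]]] := level_pair s kn.
have us1 : fsubset u (flag i (adjacent_swap s a b)).
  apply: (flag_swap_sub ab uF) => v vu; rewrite sb -eE.
  apply: contraNneq eu => vE.
  have /and3P[vD _ _] : [&& v \in D i, v \in @proper_part _ L & upset s (labels v)].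
    by rewrite -in_flag (fsubsetP uF).
  by rewrite -(labels_inj_on vD eD vE).
have old_s1 : ~~ new i (adjacent_swap s a b).
  apply/negP => new_s1; have E := uniqF _ (facet_flag new_s1) us1.
  have := eF; rewrite -E in_flag => /and3P[_ _]; rewrite eE -sb.
  exact/negP/adjacent_swapN.
have [j ji earj] := old_flag_in_ear old_s1; exists j => //=.
by apply: (ear_complex j).2 earj _; exact: fsubset_trans tu us1.
Qed.

End Ears.

(** * The dual permutohedron *)

Section ConvexHull.
Variables (R : realType) (m : nat).
Implicit Types (a x v : 'rV[R]_m) (s t : {fset 'rV[R]_m}).

Definition dot a x : R := \sum_(i < m) a 0 i * x 0 i.

Lemma dot_sum a s (w : 'rV[R]_m -> R) :
  dot a (\sum_(v <- s) w v *: v) = \sum_(v <- s) w v * dot a v.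
Proof.
rewrite /dot; under eq_bigr => i _ do rewrite summxE mulr_sumr.
rewrite exchange_big /=; apply: eq_bigr => v _.
by rewrite mulr_sumr; apply: eq_bigr => i _; rewrite !mxE mulrCA.
Qed.

Lemma dot0r a : dot a 0 = 0.
Proof. by rewrite /dot big1 // => i _; rewrite mxE mulr0. Qed.

Lemma conv_hull_mem s v : v \in s -> conv_hull s v.
Proof.
move=> vs; exists (fun u => (u == v)%:R); split.
- by move=> u _; exact: ler0n.
- rewrite (big_fsetD1 v) //= eqxx big1_fset ?addr0 // => u.
  by rewrite in_fsetD1 => /andP[/negbTE->].
- rewrite (big_fsetD1 v) //= eqxx scale1r big1_fset ?addr0 // => u.
  by rewrite in_fsetD1 => /andP[/negbTE-> _]; rewrite scale0r.
Qed.

Lemma conv_hull0 : conv_hull (fset0 : {fset 'rV[R]_m}) = set0.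
Proof.
apply/seteqP; split=> // x [w [_ + _]]; rewrite big_seq_fset0 => /eqP.
by rewrite eq_sym oner_eq0.
Qed.

Lemma conv_hull1 v : conv_hull [fset v]%fset = [set v]%classic.
Proof.
apply/seteqP; split=> x; last by move=> ->; apply: conv_hull_mem; rewrite inE.
by move=> [w []] _; rewrite !big_seq_fset1 => -> ->; rewrite scale1r.
Qed.

Lemma dot_conv_hull a b s x : (forall v, v \in s -> dot a v <= b) ->
  conv_hull s x -> dot a x <= b.
Proof.
move=> sb [w [w0 w1 ->]]; rewrite dot_sum -[leRHS]mul1r -w1 mulr_suml.
rewrite big_seq [leRHS]big_seq; apply: ler_sum => v vs.
by rewrite ler_wpM2l ?w0 ?sb.
Qed.

Definition tight a b s := [fset v in s | dot a v == b]%fset.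

(** The weights sum to one and no [b - dot a v] is negative, so a combination that attains [b] gives
    no weight to slack points. *)
Lemma face_conv_hull a b s : (forall v, v \in s -> dot a v <= b) ->
  [set x | conv_hull s x /\ dot a x = b]%classic = conv_hull (tight a b s).
Proof.
move=> sb; apply/seteqP; split=> x.
  move=> [[w [w0 w1 ->]] wb]; rewrite dot_sum in wb.
  have wE v : v \in s -> v \notin tight a b s -> w v = 0.
    rewrite !inE /= => vs; rewrite vs /= => vb.
    have : \sum_(u <- s) w u * (b - dot a u) = 0.
      under eq_bigr => u _ do rewrite mulrBr.
      by rewrite sumrB wb -mulr_suml w1 mul1r subrr.
    move/eqP; rewrite big_seq psumr_eq0; last first.
      by move=> u us; rewrite mulr_ge0 ?w0 // subr_ge0 sb.
    move=> /allP/(_ v vs); rewrite vs mulf_eq0 subr_eq0 [b == _]eq_sym (negbTE vb).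
    by rewrite orbF => /eqP.
  have ts : fsubset (tight a b s) s by apply/fsubsetP => v; rewrite !inE => /andP[].
  exists w; split.
  - by move=> v; rewrite !inE => /andP[/w0].
  - rewrite -w1; apply: (big_fset_incl _ ts) => v vs /wE; exact.
  - apply/esym; apply: (big_fset_incl _ ts) => v vs vt.
    by rewrite wE // scale0r.
move=> [w [w0 w1 ->]]; split; last first.
  rewrite dot_sum -[RHS]mul1r -w1 mulr_suml big_seq [RHS]big_seq.
  by apply: eq_bigr => v; rewrite !inE => /andP[_ /eqP->].
have ts : fsubset (tight a b s) s by apply/fsubsetP => v; rewrite !inE => /andP[].
exists (fun v => if v \in tight a b s then w v else 0); split.
- by move=> v _; case: ifP => // /w0.
- rewrite -[RHS]w1; apply/esym.
  rewrite -(big_fset_incl _ ts); last by move=> v vs /negbTE->.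
  by rewrite big_seq [RHS]big_seq; apply: eq_bigr => v ->.
rewrite -(big_fset_incl _ ts); last by move=> v vs /negbTE->; rewrite scale0r.
by rewrite big_seq [RHS]big_seq; apply: eq_bigr => v ->.
Qed.

Lemma face_conv_hullP s (F : set 'rV[R]_m) : face (conv_hull s) F ->
  exists a b, (forall v, v \in s -> dot a v <= b) /\ F = conv_hull (tight a b s).
Proof.
move=> [a [b [valid ->]]]; exists a, b.
have sb v : v \in s -> dot a v <= b by move=> /conv_hull_mem/valid.
by split; rewrite -?face_conv_hull.
Qed.

Lemma free_size_le (T : eqType) (r : seq T) (f : T -> 'rV[R]_m) : uniq r ->
    (forall w, \sum_(u <- r) w u *: f u = 0 -> forall u, u \in r -> w u = 0) ->
  (size r <= m)%N.
Proof.
move=> r_uniq lin; rewrite -(size_map f).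
suff : free (map f r).
  rewrite /free => /eqP <-; apply: leq_trans (dimvS (subvf _)) _.
  by rewrite dimvf /dim /= mul1n.
apply/(@freeP R _ _ (in_tuple (map f r))) => k k0 i.
pose w u := if insub (index u r) is Some j then k j else 0.
case: r r_uniq lin k k0 i @w => [|v0 r] r_uniq lin k k0 i w; first by case: i.
have ir : (i < size (v0 :: r))%N by rewrite -(size_map f).
have wE j : (j < size (v0 :: r))%N -> forall j' : 'I_(size (map f (v0 :: r))),
    j' = j :> nat -> w (nth v0 (v0 :: r) j) = k j'.
  move=> jr j' jj'; rewrite /w index_uniq //.
  case: insubP => [j'' _ E|]; last by rewrite -jj' ltn_ord.
  by congr (k _); apply/val_inj; rewrite E -jj'.
rewrite -(wE i ir i erefl); apply: lin; last exact: mem_nth.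
rewrite (big_nth v0) big_mkord -[RHS]k0.
have E : size (map f (v0 :: r)) = size (v0 :: r) by rewrite size_map.
rewrite [RHS](reindex (cast_ord (esym E))) /=; last first.
  by exists (cast_ord E) => j _; rewrite ?cast_ordK ?cast_ordKV.
apply: eq_bigr => j _; rewrite (wE j (ltn_ord j) (cast_ord (esym E) j) erefl).
by congr (_ *: _); rewrite -(@nth_map _ v0 _ 0 f j (v0 :: r) (ltn_ord j)).
Qed.

End ConvexHull.

Section DualPermutohedron.
Variables (R : realType) (n : nat).
Implicit Types (S T : {set 'I_n}) (a v x : 'rV[R]_n) (tau : {set {set 'I_n}}).

(* These points are the vertices of the polar of a permutohedron. *)
Definition vec S : 'rV[R]_n :=
  \row_i (if i \in S then (#|S|%:R)^-1 else - (#|~: S|%SET%:R)^-1).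

Definition vecs : {fset 'rV[R]_n} :=
  [fset vec S | S : {set 'I_n} in [pred S : {set 'I_n} | proper_subset S]]%fset.

(** For [n >= 2] the origin is already the midpoint of [vec S] and [vec (~: S)]; adding it keeps the
    polytope nonempty when there are no proper subsets. *)
Definition dual_permutohedron : set 'rV[R]_n := conv_hull (0 |` vecs)%fset.

Definition subset_chain tau : Prop :=
  {in tau, forall S, proper_subset S} /\
  {in tau &, forall S T, (S \subset T) || (T \subset S)}.

Lemma in_vecs v : reflect (exists2 S, proper_subset S & v = vec S) (v \in vecs).
Proof. by apply: (iffP (imfsetP _ _ _ _)) => -[S SP ->]; exists S. Qed.

Lemma proper_subset_card S : proper_subset S ->
  (0 < #|S|%:R :> R) /\ (0 < #|~: S|%SET%:R :> R).
Proof.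
rewrite /proper_subset => /andP[S0 S1]; rewrite !ltr0n !finset.card_gt0; split=> //.
by apply: contra S1 => /eqP/(congr1 (@finset.setC _)); rewrite finset.setCK finset.setC0 => ->.
Qed.

Lemma vec_gt0 S i : proper_subset S -> (0 < vec S 0 i) = (i \in S).
Proof.
move=> /proper_subset_card[S0 S1]; rewrite mxE; case: ifP => _.
  by rewrite invr_gt0.
by rewrite oppr_gt0 invr_lt0 ltNge ltW.
Qed.

Lemma vec_inj : {in @proper_subset n &, injective vec}.
Proof.
by move=> S T SP TP E; apply/setP => i; rewrite -!vec_gt0 // E.
Qed.

Lemma vec_neq0 S : proper_subset S -> vec S != 0.
Proof.
move=> SP; have /andP[/finset.set0Pn[i iS] _] := SP.
by apply: contraTneq iS => E; rewrite -vec_gt0 // E mxE ltxx.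
Qed.

Lemma vec_difference S i j : vec S 0 i - vec S 0 j =
  ((#|S|%:R)^-1 + (#|~: S|%SET%:R)^-1) * ((i \in S)%:R - (j \in S)%:R).
Proof. by rewrite !mxE; case: (i \in S); case: (j \in S) => /=; lra. Qed.

Lemma dot_vec a S : proper_subset S ->
  dot a (vec S) * (#|S|%:R * #|~: S|%SET%:R) =
  n%:R * (\sum_(i in S) a 0 i) - #|S|%:R * \sum_i a 0 i.
Proof.
move=> /proper_subset_card[S0 S1].
rewrite /dot (bigID (mem S)) /= [X in _ = _ - _ * X](bigID (mem S)) /=.
under eq_bigr => i iS do rewrite mxE iS.
under [X in _ + X]eq_bigr => i iS do rewrite mxE (negbTE iS).
rewrite -!mulr_suml.
have -> : n%:R = #|S|%:R + #|~: S|%SET%:R :> R.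
  by rewrite -natrD cardsC card_ord.
set A := \sum_(i in S) _; set B := \sum_(i | _) _.
set p : R := #|S|%:R; set q : R := #|~: S|%SET%:R.
have pV : p^-1 * p = 1 by rewrite mulVf // gt_eqF.
have qV : q^-1 * q = 1 by rewrite mulVf // gt_eqF.
transitivity (A * q * (p^-1 * p) - B * p * (q^-1 * q)); first by lra.
by rewrite pV qV; lra.
Qed.

Lemma sum_vec S : proper_subset S -> \sum_i vec S 0 i = 0.
Proof.
move=> SP; have [S0 S1] := proper_subset_card SP.
have := dot_vec (const_mx 1) SP; rewrite /dot.
under eq_bigr => i _ do rewrite mxE mul1r.
under [X in _ = n%:R * X - _]eq_bigr => i _ do rewrite mxE.
under [X in _ = _ - _ * X]eq_bigr => i _ do rewrite mxE.
rewrite !sumr_const card_ord [n%:R * _]mulrC subrr => /eqP.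
by rewrite !mulf_eq0 (gt_eqF S0) (gt_eqF S1) !orbF => /eqP.
Qed.

(** The slack of [dot a (vec S) <= b] times the product of the sizes of [S] and its complement.
    Without denominators it also makes sense for the empty and the full set, where it vanishes. *)
Definition excess a b S : R :=
  b * (#|S|%:R * #|~: S|%SET%:R) -
  (n%:R * (\sum_(i in S) a 0 i) - #|S|%:R * \sum_i a 0 i).

Lemma dot_vec_excess a b S : proper_subset S ->
  (dot a (vec S) <= b) = (0 <= excess a b S) /\
  (dot a (vec S) == b) = (excess a b S == 0).
Proof.
move=> SP; have [S0 S1] := proper_subset_card SP.
rewrite /excess -dot_vec // subr_ge0 subr_eq0; split.
  by rewrite ler_pM2r ?mulr_gt0.
by rewrite [LHS]eq_sym (inj_eq (mulIf _)) // mulf_neq0 // gt_eqF.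
Qed.

(* Strict concavity of k (n - k) makes the excess strictly submodular on
   incomparable sets. *)
Lemma excess_submodular a b S T :
  excess a b S + excess a b T = excess a b (S :|: T)%SET + excess a b (S :&: T)%SET
    + b * 2 * (#|S :\: T|%SET%:R * #|T :\: S|%SET%:R).
Proof.
rewrite /excess.
have cC (A : {set 'I_n}) : #|~: A|%SET%:R = n%:R - #|A|%:R :> R.
  by apply/eqP; rewrite eq_sym subr_eq -natrD addnC cardsC card_ord.
have sU : \sum_(i in (S :|: T)%SET) a 0 i =
    \sum_(i in S) a 0 i + \sum_(i in T) a 0 i - \sum_(i in (S :&: T)%SET) a 0 i.
  rewrite (big_setID T) /= [X in _ = X + _ - _](big_setID T) /=.
  have -> : ((S :|: T) :&: T = T)%SET by apply/finset.setIidPr; exact: finset.subsetUr.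
  have -> : ((S :|: T) :\: T = S :\: T)%SET by rewrite finset.setDUl finset.setDv finset.setU0.
  by lra.
have cS : #|S|%:R = #|S :&: T|%SET%:R + #|S :\: T|%SET%:R :> R by rewrite -natrD cardsID.
have cT : #|T|%:R = #|S :&: T|%SET%:R + #|T :\: S|%SET%:R :> R.
  by rewrite finset.setIC -natrD cardsID.
have cU : #|S :|: T|%SET%:R = #|S :&: T|%SET%:R + #|S :\: T|%SET%:R + #|T :\: S|%SET%:R :> R.
  have := cardsUI S T; move/(congr1 (fun k : nat => k%:R : R)).
  by rewrite !natrD cS cT => /eqP; rewrite -subr_eq => /eqP <-; lra.
by rewrite !cC sU cU cS cT; lra.
Qed.

Lemma excess0 a b : excess a b finset.set0 = 0.
Proof. by rewrite /excess finset.cards0 big_set0; lra. Qed.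

Lemma excessT a b : excess a b finset.setT = 0.
Proof.
rewrite /excess finset.setCT finset.cards0 cardsT card_ord.
under eq_bigl => i do rewrite finset.in_setT.
by lra.
Qed.

(** Uncrossing: for tight [S] and [T] the excesses of union and intersection are nonnegative, so the
    correction term of [excess_submodular] must vanish, and one of the two set differences is
    empty. *)
Lemma tight_chain a b : 0 < b ->
    (forall S, proper_subset S -> dot a (vec S) <= b) ->
  subset_chain [set S | proper_subset S & dot a (vec S) == b]%SET.
Proof.
move=> b0 valid.
have ge0 S : 0 <= excess a b S.
  have [/[dup] SP /valid|] := boolP (proper_subset S).
    by rewrite (dot_vec_excess _ _ SP).1.
  by rewrite negb_and !negbK => /orP[]/eqP->; rewrite ?excess0 ?excessT.
split=> [S|S T]; rewrite !inE; first by case/andP.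
move=> /andP[SP]; rewrite (dot_vec_excess _ _ SP).2 => /eqP S0.
move=> /andP[TP]; rewrite (dot_vec_excess _ _ TP).2 => /eqP T0.
have := excess_submodular a b S T; rewrite S0 T0 addr0 => /esym/eqP.
have pos : 0 <= b * 2 * (#|S :\: T|%SET%:R * #|T :\: S|%SET%:R).
  by rewrite !mulr_ge0 // ltW.
rewrite (paddr_eq0 (addr_ge0 (ge0 _) (ge0 _)) pos) => /andP[_]; rewrite !mulf_eq0 !pnatr_eq0 gt_eqF //=.
by rewrite !cards_eq0 !finset.setD_eq0.
Qed.

Section SeparationForm.
Variable tau : {set {set 'I_n}}.
Hypothesis chain_tau : subset_chain tau.

Definition separated (i j : 'I_n) : bool :=
  [exists S in tau, (i \in S) && (j \notin S)].

(** For a complete flag with heights [s] the entry at [i] is [2 * s i - (n - 1)]: a functional that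
    increases with the height and sums to zero. *)
Definition separation_form : 'rV[R]_n :=
  \row_i \sum_j ((separated i j)%:R - (separated j i)%:R).

Lemma separated_asym i j : separated i j -> separated j i = false.
Proof.
move=> /exists_inP[S St /andP[iS jS]]; apply/negbTE/exists_inP => -[T Tt /andP[jT iT]].
have /orP[/fintype.subsetP/(_ _ iS)|/fintype.subsetP/(_ _ jT)] := chain_tau.2 S T St Tt.
  by rewrite (negbTE iT).
by rewrite (negbTE jS).
Qed.

Lemma separation_form_sum S : \sum_(i in S) separation_form 0 i =
  \sum_(i in S) \sum_(j in ~: S) ((separated i j)%:R - (separated j i)%:R).
Proof.
under eq_bigr => i _ do rewrite mxE (bigID (mem S)) /=.
rewrite big_split /=.
set X := (X in X + _); have -> : X = 0.
  rewrite {}/X; under eq_bigr => i _ do rewrite sumrB.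
  by rewrite sumrB [X in _ - X]exchange_big subrr.
rewrite add0r; apply: eq_bigr => i _; apply: eq_bigl => j.
by rewrite finset.in_setC.
Qed.

Lemma separation_formT : \sum_i separation_form 0 i = 0.
Proof.
under eq_bigr => i _ do rewrite mxE sumrB.
by rewrite sumrB exchange_big subrr.
Qed.

Lemma separation_form_le i j : (separated i j)%:R - (separated j i)%:R <= 1 :> R.
Proof.
have [ij|ij] := boolP (separated i j); first by rewrite separated_asym // subr0.
by rewrite sub0r; apply: le_trans (ler01); rewrite oppr_le0 ler0n.
Qed.

(** With the bound [n] the excess splits over the pairs of a point in [S] and a point outside. Each
    term is nonnegative, and zero exactly when [tau] separates the pair. *)
Lemma separation_excess S : proper_subset S ->
  excess separation_form n%:R S = n%:R *
    \sum_(i in S) \sum_(j in ~: S) (1 - ((separated i j)%:R - (separated j i)%:R)).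
Proof.
move=> SP; rewrite /excess separation_form_sum separation_formT mulr0 subr0 -mulrBr.
congr (_ * _); under [RHS]eq_bigr => i _ do rewrite sumrB sumr_const.
rewrite sumrB sumr_const -natrM mulnC natrM -[in RHS]mulr_natr.
by congr (_ - _); rewrite mulrC.
Qed.

(** A chain with the empty and the full set adjoined is closed under union and intersection, so
    [separating_family] applies to it. *)
Lemma separation_form_tight S : proper_subset S -> S \in tau \/
  exists i j, [/\ i \in S, j \notin S & ~~ separated i j].
Proof.
move=> SP; have [|nsep] := pselect (exists i j, [/\ i \in S, j \notin S & ~~ separated i j]).
  by right.
left; have : S \in [predU [pred S | S \in tau] & [pred S | ~~ proper_subset S]].
  apply: separating_family.
  - by rewrite !inE /proper_subset eqxx orbT.
  - by rewrite !inE /proper_subset eqxx andbF orbT.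
  - move=> A B; rewrite !inE => /orP[At|] => [/orP[Bt|]|].
    + have /orP[/finset.setUidPr->|/finset.setUidPl->] := chain_tau.2 A B At Bt; by rewrite ?At ?Bt.
    + rewrite negb_and !negbK => /orP[]/eqP->; first by rewrite finset.setU0 At.
      by rewrite finset.setUT /proper_subset eqxx andbF orbT.
    + rewrite negb_and !negbK => /orP[]/eqP-> H; first by rewrite finset.set0U.
      by rewrite finset.setTU /proper_subset eqxx andbF orbT.
  - move=> A B; rewrite !inE => /orP[At|] => [/orP[Bt|]|].
    + have /orP[/finset.setIidPl->|/finset.setIidPr->] := chain_tau.2 A B At Bt; by rewrite ?At ?Bt.
    + rewrite negb_and !negbK => /orP[]/eqP->; last by rewrite finset.setIT At.
      by rewrite finset.setI0 /proper_subset eqxx orbT.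
    + rewrite negb_and !negbK => /orP[]/eqP-> H; last by rewrite finset.setTI.
      by rewrite finset.set0I /proper_subset eqxx orbT.
  move=> i j iS jS; have : separated i j.
    by apply: contraT => ij; case: nsep; exists i, j.
  by move=> /exists_inP[A At /andP[iA jA]]; exists A; rewrite inE /= At.
by rewrite !inE SP orbF.
Qed.

Lemma chain_face : exists a b, [/\ 0 < b,
    forall S, proper_subset S -> dot a (vec S) <= b &
    forall S, proper_subset S -> (dot a (vec S) == b) = (S \in tau)].
Proof.
(* Here the bound [n] would be zero while [0 < b] is wanted; as there are no proper subsets, any
   positive bound does. *)
have [n0|n0] := posnP n.
  have noP S : ~~ proper_subset S.
    apply/negP => /andP[/finset.set0Pn[i _] _].
    by have := leq_ltn_trans (leq0n i) (ltn_ord i); rewrite [X in (_ < X)%N]n0.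
  by exists 0, 1; split=> // S SP; have := noP S; rewrite SP.
exists separation_form, n%:R.
have ge0 S i j : 0 <= 1 - ((separated i j)%:R - (separated j i)%:R) :> R.
  by rewrite subr_ge0 separation_form_le.
have sum_ge0 S i : 0 <= \sum_(j in ~: S) (1 - ((separated i j)%:R - (separated j i)%:R)) :> R.
  by apply: sumr_ge0 => j _; exact: ge0.
split=> [|S SP|S SP]; first by rewrite ltr0n.
  rewrite (dot_vec_excess _ _ SP).1 separation_excess // mulr_ge0 //.
  exact: sumr_ge0.
rewrite (dot_vec_excess _ _ SP).2 separation_excess // mulf_eq0 pnatr_eq0 gtn_eqF //=.
apply/idP/idP => [|St].
  have [//|[i [j [iS jS ij]]]] := separation_form_tight SP.
  move=> /eqP/(psumr_eq0P (fun k _ => sum_ge0 S k))/(_ i iS).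
  move/(psumr_eq0P (fun k _ => ge0 S i k))/(_ j).
  rewrite finset.in_setC jS (negbTE ij) sub0r opprK => /(_ isT) E.
  suff : 0 < 0 :> R by rewrite ltxx.
  by rewrite -[X in _ < X]E ltr_wpDr ?ler0n ?ltr01.
apply/eqP; rewrite big1 // => i iS; rewrite big1 // => j; rewrite finset.in_setC => jS.
have ij : separated i j by apply/exists_inP; exists S; rewrite // iS.
by rewrite ij separated_asym // subr0 subrr.
Qed.

End SeparationForm.
End DualPermutohedron.

(** * The face complex of the dual permutohedron *)

Section DualPermutohedronBoundary.
Variables (R : realType) (n : nat).
Implicit Types (S T : {set 'I_n}) (a v x : 'rV[R]_n) (tau : {set {set 'I_n}}).
Implicit Type s : {fset 'rV[R]_n}.

Local Notation vec := (@vec R n).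
Local Notation vecs := (@vecs R n).
Local Notation P := (@dual_permutohedron R n).

(** Extend the chain to a complete flag. The difference of the coordinates at two consecutive
    heights vanishes on the vectors of all levels but one, so it isolates a single coefficient. *)
Lemma chain_vec_free tau s : subset_chain tau ->
    (forall v, v \in s -> exists2 S, S \in tau & v = vec S) ->
    forall w, \sum_(v <- s) w v *: v = 0 -> forall v, v \in s -> w v = 0.
Proof.
move=> [tauP tau_ch] s_tau w w0 v vs; have [S St vS] := s_tau v vs.
have [t [t_up _]] := @chain_chamber n tau val val_inj tau_ch.
have [k kn Sk] := proper_upset_level (t_up S St) (tauP S St).
have [i [j [jk ji]]] := level_pair t kn.
have [S0 S1] := proper_subset_card R (tauP S St).
have : \sum_(u <- s) w u * (u 0 j - u 0 i) = 0.
  have := congr1 (fun x : 'rV[R]_n => x 0 j - x 0 i) w0.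
  rewrite !mxE subrr => E; rewrite -[RHS]E !summxE -sumrB.
  by apply: eq_bigr => u _; rewrite !mxE mulrBr.
rewrite (big_fsetD1 v) //= big1_fset ?addr0 => [|u].
  rewrite {2 3}vS vec_difference Sk -jk !inE leqnn ji ltnn subr0 mulr1 => /eqP.
  rewrite mulf_eq0 => /orP[/eqP //|]; rewrite gt_eqF // -ji jk -Sk.
  by rewrite addr_gt0 // invr_gt0.
rewrite in_fsetD1 => /andP[uv us] _; have [T Tt uT] := s_tau u us.
have -> : u 0 j - u 0 i = 0; last by rewrite mulr0.
rewrite uT vec_difference (upset_adjacent ji (t_up T Tt)) ?subrr ?mulr0 //.
by apply: contra uv => /eqP; rewrite jk -Sk uT vS => ->.
Qed.

Lemma dual_permutohedron0 : P 0.
Proof. by apply: conv_hull_mem; rewrite in_fset1U eqxx. Qed.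

Definition tight_sets a (b : R) : {set {set 'I_n}} :=
  [set S | proper_subset S & dot a (vec S) == b]%SET.

Lemma tight_vecs a b : 0 < b ->
  tight a b (0 |` vecs)%fset =
  [fset vec S | S : {set 'I_n} in tight_sets a b]%fset.
Proof.
move=> b0; apply/fsetP => v; rewrite !inE /=; apply/andP/imfsetP => /=.
  move=> [/orP[/eqP->|/in_vecs[S SP ->]]]; first by rewrite dot0r lt_eqF.
  by move=> Sb; exists S; rewrite // !inE SP.
by move=> [S + ->]; rewrite !inE => /andP[SP Sb]; split=> //; apply/orP; right; apply/in_vecs; exists S.
Qed.

Lemma proper_face_tight F : proper_face P F -> exists a b,
  [/\ 0 < b, forall S, proper_subset S -> dot a (vec S) <= b
    & F = conv_hull [fset vec S | S : {set 'I_n} in tight_sets a b]%fset].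
Proof.
move=> [/face_conv_hullP[a [b [valid FE]]] FP]; exists a, b.
have validS S : proper_subset S -> dot a (vec S) <= b.
  by move=> SP; apply: valid; rewrite in_fset1U; apply/orP; right; apply/in_vecs; exists S.
have b_ge0 : 0 <= b by rewrite -(dot0r a) valid // in_fset1U eqxx.
have b0 : 0 < b.
  (* If [b = 0], the excesses of [S] and its complement are nonnegative with sum zero, so every
     point is tight and the face is all of [P]. *)
  rewrite lt_neqAle b_ge0 andbT; apply/eqP => b0; apply: FP; rewrite FE.
  congr conv_hull; apply/fsetP => v; rewrite !inE /= -b0.
  have [->|v0] /= := eqVneq v 0; first by rewrite dot0r eqxx.
  apply/andP/in_vecs => [[/in_vecs//]|vv]; split; first exact/in_vecs.
  have [S SP ->] := vv; rewrite (dot_vec_excess _ _ SP).2.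
  have [S0 S1] := proper_subset_card R SP.
  have CP : proper_subset (~: S)%SET.
    apply/andP; split; first by rewrite -finset.card_gt0 -(ltr0n R).
    by apply: contraTneq S0 => E; rewrite -(finset.setCK S) E finset.setCT finset.cards0 ltxx.
  have := validS _ SP; have := validS _ CP.
  rewrite (dot_vec_excess _ _ SP).1 (dot_vec_excess _ _ CP).1 -b0.
  have := excess_submodular a 0 S (~: S)%SET.
  rewrite finset.setUCr finset.setICr excess0 excessT !mul0r !addr0 => /eqP.
  by rewrite addr_eq0 => /eqP-> h1 h2; apply/eqP/le_anti/andP; split; lra.
by split=> //; rewrite FE tight_vecs.
Qed.

Lemma tight_face a b : 0 < b -> (forall S, proper_subset S -> dot a (vec S) <= b) ->
  proper_face P (conv_hull [fset vec S | S : {set 'I_n} in tight_sets a b]%fset).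
Proof.
move=> b0 validS.
have valid v : v \in (0 |` vecs)%fset -> dot a v <= b.
  by rewrite in_fset1U => /orP[/eqP->|/in_vecs[S SP ->]]; [rewrite dot0r ltW|exact: validS].
rewrite -tight_vecs // -face_conv_hull //; split.
  by exists a, b; split=> // x; exact: dot_conv_hull.
move=> E; have := dual_permutohedron0; rewrite -E => -[_].
by rewrite dot0r => /eqP; rewrite lt_eqF.
Qed.

Lemma proper_face_simplex F : proper_face P F -> is_simplex F.
Proof.
move=> /proper_face_tight[a [b [b0 valid ->]]].
exists [fset vec S | S : {set 'I_n} in tight_sets a b]%fset => // w _.
apply: chain_vec_free; first exact: tight_chain b0 valid.
by move=> v /imfsetP[S /= St ->]; exists S.
Qed.

Lemma vec_vertex S : proper_subset S -> polytope_vertices P (vec S).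
Proof.
move=> SP; have ch : subset_chain [set S]%SET.
  by split=> [T|T U]; rewrite !inE => /eqP-> // /eqP->; rewrite fintype.subxx.
have [a [b [b0 valid tightE]]] := chain_face R ch.
have [] := tight_face b0 valid.
suff -> : [fset vec S | S : {set 'I_n} in tight_sets a b]%fset = [fset vec S]%fset.
  by rewrite conv_hull1.
apply/fsetP => v; rewrite inE; apply/imfsetP/eqP => /= [[T]|->].
  by rewrite inE => /andP[TP]; rewrite tightE // inE => /eqP->.
by exists S; rewrite //= inE SP /= tightE // inE.
Qed.

Lemma vertices_face a b : 0 < b ->
    (forall S, proper_subset S -> dot a (vec S) <= b) ->
  (polytope_vertices P `&`
    conv_hull [fset vec S | S : {set 'I_n} in tight_sets a b]%fset)%classic =
  [set` [fset vec S | S : {set 'I_n} in tight_sets a b]%fset]%classic.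
Proof.
move=> b0 valid; apply/seteqP; split=> v /=; last first.
  move=> vt; split; last exact: conv_hull_mem.
  by move: vt => /imfsetP[S /=]; rewrite inE => /andP[SP _] ->; exact: vec_vertex.
move=> [/face_conv_hullP[a' [b' [valid' vE]]] vF].
have vV : v \in (0 |` vecs)%fset.
  have [tE|[u ut]] := fset_0Vmem (tight a' b' (0 |` vecs)%fset).
    by have : [set v]%classic v by []; rewrite vE tE conv_hull0.
  have : conv_hull (tight a' b' (0 |` vecs)%fset) u by exact: conv_hull_mem.
  by rewrite -vE => /= <-; move: ut; rewrite !inE => /andP[].
have : dot a v = b.
  have : conv_hull (tight a b (0 |` vecs)%fset) v by rewrite tight_vecs.
  by rewrite -face_conv_hull => [[]//|u]; rewrite in_fset1U => /orP[/eqP->|/in_vecs[S SP ->]];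
    [rewrite dot0r ltW|exact: valid].
move: vV; rewrite in_fset1U => /orP[/eqP->|/in_vecs[S SP ->] /eqP Sb].
  by rewrite dot0r => /eqP; rewrite lt_eqF.
by apply/imfsetP; exists S; rewrite //= inE SP.
Qed.

Lemma boundary_dual_permutohedron : boundary_complex P =
  [set s | exists2 tau, subset_chain tau & s = [fset vec S | S : {set 'I_n} in tau]%fset]%classic.
Proof.
apply/seteqP; split=> s.
  move=> [F /proper_face_tight[a [b [b0 valid ->]]]]; rewrite vertices_face // => sE.
  exists (tight_sets a b); first exact: tight_chain.
  apply/fsetP => v; have := congr1 (fun A : set _ => A v) sE => /= E.
  by apply/idP/idP; rewrite E.
move=> [tau ch ->]; have [a [b [b0 valid tightE]]] := chain_face R ch.
have -> : tau = tight_sets a b.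
  apply/setP => S; rewrite inE; apply/idP/andP => [St|[SP]]; last by rewrite tightE.
  by rewrite tightE ?ch.1.
by eexists; [exact: (tight_face b0 valid)|rewrite vertices_face].
Qed.

Lemma dual_permutohedron_dim : affine_dim P n.-1.
Proof.
split.
  pose u (k : nat) := vec (level 1%g k).
  pose s := [fset u (val k).+1 | k : 'I_n.-1 in 'I_n.-1]%fset.
  have levelP (k : 'I_n.-1) : proper_subset (level (1%g : {perm 'I_n}) k.+1).
    by apply: level_proper; rewrite /= -ltn_predRL.
  have s0 : 0 \notin s.
    by apply/imfsetP => -[k _ /esym/eqP]; rewrite (negbTE (vec_neq0 R (levelP k))).
  exists (0 |` s)%fset; split.
  - move=> v /=; rewrite in_fset1U => /orP[/eqP->|/imfsetP[k _ ->]].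
      exact: dual_permutohedron0.
    apply: conv_hull_mem; rewrite in_fset1U; apply/orP; right; apply/in_vecs.
    by exists (level 1%g k.+1).
  - move=> w; rewrite !big_fsetU1 //= scaler0 add0r => w1 w0.
    have ws v : v \in s -> w v = 0.
      pose tau := [set level (1%g : {perm 'I_n}) (val k).+1 | k : 'I_n.-1]%SET.
      apply: (@chain_vec_free tau) => //.
        split=> [S /imsetP[k _ ->]|S T /imsetP[k _ ->] /imsetP[l _ ->]].
          exact: levelP.
        exact: upset_comparable (upset_level _ _) (upset_level _ _).
      move=> x /imfsetP[k _ ->]; exists (level 1%g k.+1) => //.
      by apply/imsetP; exists k.
    move=> v; rewrite in_fset1U => /orP[/eqP->|/ws//]; move: w1.
    by rewrite big_seq big1 ?addr0 // => x /ws.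
  - rewrite cardfsU1 s0 add1n card_imfset /= ?size_enum_ord // => k l /vec_inj.
    move=> /(_ (levelP k) (levelP l))/level_inj E; apply/val_inj/eqP.
    by rewrite -eqSS; apply/eqP/E; rewrite -ltn_predRL.
(* For [n = 0] the bound [n.-1.+1] is one instead of [n]. *)
move=> s sP aff; have [n0|n0] := posnP n.
  have sub : fsubset s [fset 0]%fset.
    apply/fsubsetP => v _; rewrite inE; apply/eqP/rowP => i.
    by have := leq_ltn_trans (leq0n i) (ltn_ord i); rewrite [X in (_ < X)%N]n0.
  by have := fsubset_leq_card sub; rewrite cardfs1 => /leq_trans; apply.
rewrite prednK //; have sum0 v : v \in s -> \sum_i v 0 i = 0.
  move=> /sP[w [_ _ ->]]; under eq_bigr => i _ do rewrite summxE.
  rewrite exchange_big /= big_seq big1 // => u.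
  under eq_bigr => i _ do rewrite mxE.
  rewrite -mulr_sumr in_fset1U => /orP[/eqP->|/in_vecs[S SP ->]]; last by rewrite sum_vec ?mulr0.
  by rewrite big1 ?mulr0 // => i _; rewrite mxE.
(* Off the hyperplane of sum zero, translating by the all-ones vector turns
   affine into linear independence. *)
apply: (@free_size_le R n _ s (fun v => v + const_mx 1)); first exact: fset_uniq.
move=> w; under eq_bigr => v _ do rewrite scalerDr.
rewrite big_split /= -scaler_suml => E.
have w1 : \sum_(v <- s) w v = 0.
  have : \sum_i (\sum_(v <- s) w v *: v + (\sum_(v <- s) w v) *: const_mx 1 : 'rV[R]_n) 0 i = 0.
    by rewrite E big1 // => i _; rewrite mxE.
  under eq_bigr => i _ do rewrite !mxE mulr1 summxE.
  rewrite big_split /= exchange_big /= big_seq big1 => [|v vs]; last first.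
    by under eq_bigr => i _ do rewrite mxE; rewrite -mulr_sumr sum0 ?mulr0.
  rewrite sumr_const card_ord add0r => /eqP.
  by rewrite mulrn_eq0 -[n == 0%N]leqn0 leqNgt n0 /= => /eqP.
by apply: aff => //; move: E; rewrite w1 scale0r addr0.
Qed.

Lemma simplicial_dual_permutohedron : simplicial_polytope P n.-1.
Proof.
split; last exact: proper_face_simplex.
by split; [exists (0 |` vecs)%fset|exact: dual_permutohedron_dim].
Qed.

End DualPermutohedronBoundary.

(** * Upper ideals of the weak order are balls *)

Section Gaps.
Variables (R : realType) (n : nat).
Implicit Types (x y : 'I_n -> R) (s : {perm 'I_n}) (S T : {set 'I_n}) (w : {set 'I_n} -> R).

Definition in_chamber s x : Prop := forall a b, (s b < s a)%N -> x b <= x a.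

Lemma in_chamber_le s x a b : in_chamber s x -> (s b <= s a)%N -> x b <= x a.
Proof.
move=> sx; rewrite leq_eqVlt => /predU1P[/val_inj/perm_inj->//|]; exact: sx.
Qed.

Lemma in_chamber_affine s x c d : 0 <= c -> in_chamber s x ->
  in_chamber s (fun i => c * x i + d).
Proof. by move=> c0 sx a b /sx ab; rewrite lerD2r ler_wpM2l. Qed.

(* The fallback value of the minimum exceeds all its arguments. *)
Definition gap S x : R :=
  Order.max 0 (\big[Order.min/(\sum_a \sum_b `|x a - x b|)]_(p : 'I_n * 'I_n |
    (p.1 \in S) && (p.2 \notin S)) (x p.1 - x p.2)).

Definition total x : R := \sum_(S | proper_subset S) gap S x.

(** The point with coordinates [w] along the rays of the Coxeter fan, spanned by indicator vectors.
    On each chamber [gap] reads the coordinates back. *)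
Definition superpose w : 'I_n -> R :=
  fun i => \sum_(S | proper_subset S) w S * (i \in S)%:R.

Lemma gap_ge0 S x : 0 <= gap S x.
Proof. by rewrite le_max lexx. Qed.

Lemma gap_not_upset s x S : in_chamber s x -> ~~ upset s S -> gap S x = 0.
Proof.
move=> sx /forallPn[a /forallPn[b]]; rewrite !negb_imply -leqNgt => /and3P[aS bS ab].
apply/eqP; rewrite eq_le gap_ge0 andbT ge_max lexx /=.
apply: (le_trans (bigmin_le_cond _ _ (j := (a, b)) _)) => /=; first by rewrite aS.
by rewrite subr_le0; exact: in_chamber_le ab.
Qed.

(** Points of the level have value at least [x b] and all others at most [x a], so the minimum is
    attained at the adjacent pair. *)
Lemma gap_level s x a b : in_chamber s x -> s b = (s a).+1 :> nat ->
  gap (level s (s b)) x = x b - x a.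
Proof.
move=> sx ab; have xab : 0 <= x b - x a by rewrite subr_ge0 sx // ab.
rewrite /gap; set m := \big[_/_]_(_ | _) _.
suff -> : m = x b - x a by apply/max_idPr.
apply/le_anti/andP; split.
  apply: (bigmin_le_cond _ _ (j := (b, a))) => /=.
  by rewrite !inE leqnn ab ltnn.
apply: le_bigmin => [|[i j] /=].
  rewrite -(ger0_norm xab) (bigD1 b) //= (bigD1 a) //= -addrA lerDl addr_ge0 //.
    by apply: sumr_ge0 => j _.
  by apply: sumr_ge0 => j _; apply: sumr_ge0 => l _.
rewrite !inE -ltnNge ab ltnS => /andP[bi ja].
by rewrite lerB // (in_chamber_le sx) // ab.
Qed.

Lemma sum_adjacent s w a b : (forall S, proper_subset S -> ~~ upset s S -> w S = 0) ->
    s b = (s a).+1 :> nat ->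
  superpose w b - superpose w a = w (level s (s b)).
Proof.
move=> w0 ab; rewrite -sumrB (bigD1 (level s (s b))) /=; last first.
  by rewrite level_proper // ltn_ord ab.
rewrite !inE leqnn ab ltnn mulr1 mulr0 subr0 big1 ?addr0 // => S /andP[SP SN].
have [uS|nS] := boolP (upset s S); last by rewrite w0 // !mul0r subr0.
by rewrite (upset_adjacent ab uS) ?subrr // ab.
Qed.

Lemma superpose_chamber s w :
    (forall S, proper_subset S -> 0 <= w S) ->
    (forall S, proper_subset S -> ~~ upset s S -> w S = 0) ->
  in_chamber s (superpose w).
Proof.
move=> w_ge0 w0 a b ba; apply: ler_sum => S SP.
have [/upsetP uS|nS] := boolP (upset s S); last by rewrite w0 // !mul0r.
rewrite ler_wpM2l ?w_ge0 // ler_nat; case: (boolP (b \in S)) => // bS.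
rewrite lt0b; apply: contraT => aS; have := uS b a bS aS.
by rewrite ltnNge ltnW.
Qed.

Lemma gap_superpose s w S : proper_subset S ->
    (forall T, proper_subset T -> 0 <= w T) ->
    (forall T, proper_subset T -> ~~ upset s T -> w T = 0) ->
  gap S (superpose w) = w S.
Proof.
move=> SP w_ge0 w0; have sx := superpose_chamber w_ge0 w0.
have [uS|nS] := boolP (upset s S); last by rewrite (gap_not_upset sx) ?w0.
have [k kn ->] := proper_upset_level uS SP; have [a [b [<- ab]]] := level_pair s kn.
by rewrite (gap_level sx ab) (sum_adjacent w0 ab).
Qed.

Lemma perm_connected s (F : 'I_n -> R) :
    (forall a b, s b = (s a).+1 :> nat -> F b = F a) -> forall a b, F a = F b.
Proof.
move=> step; suff H a b : (s a <= s b)%N -> F a = F b.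
  by move=> a b; have [/H|/ltnW/H] := leqP (s a) (s b).
move: {2}(s b - s a)%N (erefl (s b - s a)%N) => d; elim: d b => [|d IHd] b.
  move/eqP; rewrite subn_eq0 => ba ab; congr F; apply/(perm_inj (s := s))/val_inj/eqP.
  by rewrite /= eqn_leq ab ba.
move=> dE ab; have ab' : (s a < s b)%N by rewrite -subn_gt0 dE.
have sb0 := leq_ltn_trans (leq0n _) ab'.
have [c [b' [b'E cb]]] := level_pair s (introT andP (conj sb0 (ltn_ord (s b)))).
have bb' : b' = b by apply/(perm_inj (s := s))/val_inj.
rewrite {}bb' in cb; rewrite (step c b cb); apply: IHd; last by rewrite -ltnS -cb.
by apply/eqP; rewrite -eqSS -dE cb subSn // -ltnS -cb.
Qed.

(** Gaps ignore constants, so only differences can be recovered; between consecutive heights both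
    sides jump by the gap of the level in between. *)
Lemma superpose_gap s x a b : in_chamber s x ->
  superpose (fun S => gap S x) a - superpose (fun S => gap S x) b = x a - x b.
Proof.
move=> sx; set F := superpose _.
have /(_ a b) E : forall i j, F i - x i = F j - x j.
  apply: (@perm_connected s (fun i => F i - x i)) => i j ij.
  have := @sum_adjacent s (fun S => gap S x) i j; rewrite (gap_level sx ij).
  by move=> /(_ (fun S _ => @gap_not_upset s x S sx) ij); rewrite -/F; lra.
by move: E; lra.
Qed.

Lemma gap_affine x c d S : proper_subset S -> 0 <= c ->
  gap S (fun i => c * x i + d) = c * gap S x.
Proof.
move=> SP c0; have [s sP] := @chamber n _ R x val val_inj.
have sx : in_chamber s x.
  by move=> a b; rewrite sP => /orP[/ltW//|/andP[/eqP->]].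
have sx' := in_chamber_affine d c0 sx.
have [uS|nS] := boolP (upset s S); last first.
  by rewrite (gap_not_upset sx) // (gap_not_upset sx') // mulr0.
have [k kn ->] := proper_upset_level uS SP; have [a [b [<- ab]]] := level_pair s kn.
by rewrite (gap_level sx ab) (gap_level sx' ab); lra.
Qed.

Lemma total_affine x c d : 0 <= c -> total (fun i => c * x i + d) = c * total x.
Proof.
by move=> c0; rewrite /total mulr_sumr; apply: eq_bigr => S SP; rewrite gap_affine.
Qed.

Lemma total_ge0 x : 0 <= total x.
Proof. by apply: sumr_ge0 => S _; exact: gap_ge0. Qed.

Lemma total_eq0 x a b : total x = 0 -> x a = x b.
Proof.
move=> /(psumr_eq0P (fun S _ => gap_ge0 S x)) x0.
have [s sP] := @chamber n _ R x val val_inj.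
have sx : in_chamber s x.
  by move=> i j; rewrite sP => /orP[/ltW//|/andP[/eqP->]].
have := superpose_gap a b sx; rewrite /superpose !big1 => [|S SP|S SP].
- by move/esym/eqP; rewrite subrr subr_eq0 => /eqP.
- by rewrite x0 // mul0r.
- by rewrite x0 // mul0r.
Qed.

End Gaps.

Section UpperRegion.
Variables (R : realType) (n : nat) (N : pred {perm 'I_n}).
Hypothesis N_up : forall s t : {perm 'I_n}, N s ->
  (forall a b : 'I_n, (b < a)%N -> (s b < s a)%N -> (t b < t a)%N) -> N t.
Hypothesis N_neq0 : exists s, N s.
Hypothesis N_nmax : forall s, N s -> exists a b : 'I_n, (b < a)%N && (s b < s a)%N.
Implicit Types (x y : 'I_n -> R) (s : {perm 'I_n}).

Definition region x : Prop := exists2 s, N s & in_chamber s x.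

(** Only the pairs [b < a] kept in order by [s] impose conditions: sorting [x] with ties broken by
    the natural order gives a permutation above [s] in the weak order, hence in [N]. All these
    conditions persist in the direction of the height. *)
Lemma regionP x : region x <-> exists2 s, N s &
  forall a b : 'I_n, (b < a)%N -> (s b < s a)%N -> x b <= x a.
Proof.
split=> [[s Ns sx]|[s Ns sx]]; first by exists s => // a b _; exact: sx.
have [t tP] := @chamber n _ R x val val_inj; exists t.
  apply: N_up Ns _ => a b ba sba; rewrite tP.
  by have := sx a b ba sba; rewrite le_eqVlt => /predU1P[->|->//]; rewrite eqxx ltxx.
by move=> a b; rewrite tP => /orP[/ltW//|/andP[/eqP->]].
Qed.

Lemma region_affine x c d : 0 <= c -> region x -> region (fun i => c * x i + d).
Proof. by move=> c0 [s Ns sx]; exists s => //; exact: in_chamber_affine. Qed.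

(** For [p.2 < p.1], the least multiple of the vertical direction to add to [y] so that the value at
    [p.2] no longer exceeds the one at [p.1]. *)
Definition slope (p : 'I_n * 'I_n) y : R := (y p.2 - y p.1) / (p.1%:R - p.2%:R).

Definition ascents s : {pred 'I_n * 'I_n} :=
  [pred p : 'I_n * 'I_n | (p.2 < p.1)%N && (s p.2 < s p.1)%N].

(** The starting value is itself one of the slopes, hence harmless. For [s] in [N] an ascent exists
    by [N_nmax]; without ascents every translate would qualify and there would be no least one. *)
Definition max_slope s y : R :=
  if [pick p in ascents s] is Some p0
  then \big[Order.max/slope p0 y]_(p in ascents s) slope p y else 0.

(* The region is the epigraph of this function in the direction (1, 2, ..., n),
   which is interior to the chamber of the identity. *)
Definition height y : R :=
  if [pick s | N s] is Some s0
  then \big[Order.min/max_slope s0 y]_(s | N s) max_slope s y else 0.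

Lemma max_slope_le s y t : N s -> max_slope s y <= t <->
  forall p, p \in ascents s -> slope p y <= t.
Proof.
move=> Ns; rewrite /max_slope; case: pickP => [p0 p0s|no].
  by split=> [/bigmax_leP[]|H] //; apply/bigmax_leP; split=> //; apply: H.
by have [a [b ab]] := N_nmax Ns; have := no (a, b); rewrite inE ab.
Qed.

Lemma height_le y t : height y <= t <-> region (fun i => y i + t * i%:R).
Proof.
rewrite regionP /height; case: pickP => [s0 Ns0|no]; last first.
  by have [s Ns] := N_neq0; have := no s; rewrite Ns.
have slopeE s : N s -> max_slope s y <= t <-> forall a b : 'I_n, (b < a)%N ->
    (s b < s a)%N -> y b + t * b%:R <= y a + t * a%:R.
  move=> Ns; rewrite max_slope_le //.
  have E (a b : 'I_n) : (b < a)%N ->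
      (slope (a, b) y <= t) = (y b + t * b%:R <= y a + t * a%:R).
    move=> ba; have ab0 : 0 < a%:R - b%:R :> R by rewrite subr_gt0 ltr_nat.
    rewrite /slope ler_pdivrMr //=; apply/idP/idP; lra.
  split=> [H a b ba sba|H [a b]]; first by rewrite -E // H // inE /= ba.
  by rewrite inE /= => /andP[ba sba]; rewrite E // H.
split=> [/bigmin_leP[le|[s Ns le]]|[s Ns le]].
- by exists s0 => //; apply/slopeE.
- by exists s => //; apply/slopeE.
by apply/bigmin_leP; right; exists s => //; apply/slopeE.
Qed.

Lemma height_homogeneous y c : 0 < c -> height (fun i => c * y i) = c * height y.
Proof.
move=> c0; have H t : height (fun i => c * y i) <= t <-> c * height y <= t.
  rewrite height_le mulrC -ler_pdivlMr // height_le.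
  split=> [/(region_affine 0 (c := c^-1))|/(region_affine 0 (c := c))].
    rewrite invr_ge0 ltW // => /(_ isT); congr (region _); apply/funext => i.
    by rewrite addr0 mulrDr mulKf ?gt_eqF // mulrA [t / c]mulrC.
  rewrite ltW // => /(_ isT); congr (region _); apply/funext => i.
  by rewrite addr0 mulrDr mulrA [c * (t / c)]mulrC divfK ?gt_eqF.
by apply/le_anti/andP; split; apply/H.
Qed.

Lemma height0 : height (fun=> 0) = 0.
Proof.
have := @height_homogeneous (fun=> 0) 2 (ltr0n _ 2).
have -> : (fun _ : 'I_n => 2 * 0 : R) = (fun=> 0) by apply/funext => i; rewrite mulr0.
by lra.
Qed.

End UpperRegion.

Section Coordinates.
Variables (R : realType) (k : nat).
Implicit Types (x : 'I_k.+2 -> R) (z : 'rV[R]_k).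

(* Modulo constants, a point of R^(k+2) is the sum of a multiple of the
   direction (0, 1, ..., k+1) and of a point whose first two coordinates vanish. *)
Definition lift_row z : 'I_k.+2 -> R := fun i => row_mx (0 : 'rV[R]_2) z 0 i.

Definition rise x : R := x (lift ord0 ord0) - x ord0.

Definition residue x : 'rV[R]_k :=
  \row_j (x (rshift 2 j) - x ord0 - rise x * (rshift 2 j : 'I_k.+2)%:R).

Lemma coordinatesE x i : x i = lift_row (residue x) i + rise x * i%:R + x ord0.
Proof.
rewrite /lift_row; case: (@split_ordP 2 k i) => j ->.
  rewrite row_mxEl mxE add0r /rise.
  case: j => -[|[|//]] j2 /=.
    have -> : lshift k (Ordinal j2) = ord0 by exact: val_inj.
    by rewrite mulr0 add0r.
  have -> : lshift k (Ordinal j2) = lift ord0 ord0 by exact: val_inj.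
  by rewrite mulr1 subrK.
by rewrite row_mxEr mxE; lra.
Qed.

Lemma rise_affine x c d : rise (fun i => c * x i + d) = c * rise x.
Proof. by rewrite /rise; lra. Qed.

Lemma residue_affine x c d : residue (fun i => c * x i + d) = c *: residue x.
Proof. by apply/rowP => j; rewrite !mxE rise_affine; lra. Qed.

Lemma lift_rowZ c z i : lift_row (c *: z) i = c * lift_row z i.
Proof.
rewrite /lift_row; case: (@split_ordP 2 k i) => j ->; rewrite ?row_mxEl ?row_mxEr !mxE //.
by rewrite mulr0.
Qed.

Lemma lift_row0 i : lift_row 0 i = 0.
Proof. by rewrite /lift_row row_mx0 mxE. Qed.

Lemma rise_lift z t : rise (fun i => lift_row z i + t * i%:R) = t.
Proof.
have E (j : 'I_2) : lift_row z (lshift k j) = 0 by rewrite /lift_row row_mxEl mxE.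
have E0 : lift_row z ord0 = 0 by rewrite -(E ord0); congr lift_row; exact: val_inj.
have E1 : lift_row z (lift ord0 ord0) = 0.
  by rewrite -(E (lift ord0 ord0)); congr lift_row; exact: val_inj.
by rewrite /rise E0 E1 /= mulr0 mulr1 !add0r subr0.
Qed.

Lemma residue_lift z t : residue (fun i => lift_row z i + t * i%:R) = z.
Proof.
apply/rowP => j; rewrite mxE rise_lift.
have -> : lift_row z ord0 = 0.
  have -> : ord0 = lshift k (ord0 : 'I_2) :> 'I_k.+2 by exact: val_inj.
  by rewrite /lift_row row_mxEl mxE.
by rewrite /lift_row row_mxEr /=; lra.
Qed.

Definition euclidean_norm z : R := Num.sqrt (\sum_(i < k) z 0 i ^+ 2).

Lemma euclidean_norm_ge0 z : 0 <= euclidean_norm z.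
Proof. exact: sqrtr_ge0. Qed.

Lemma euclidean_normZ c z : 0 <= c -> euclidean_norm (c *: z) = c * euclidean_norm z.
Proof.
move=> c0; rewrite /euclidean_norm; under eq_bigr => i _ do rewrite mxE exprMn.
by rewrite -mulr_sumr sqrtrM ?sqr_ge0 // sqrtr_sqr ger0_norm.
Qed.

Lemma euclidean_norm_eq0 z : euclidean_norm z = 0 -> z = 0.
Proof.
move=> /eqP; rewrite sqrtr_eq0 => le0; apply/rowP => i; rewrite mxE.
have : \sum_(i < k) z 0 i ^+ 2 = 0.
  by apply/le_anti; rewrite le0 sumr_ge0 // => j _; exact: sqr_ge0.
move/(psumr_eq0P (fun j _ => sqr_ge0 (z 0 j)))/(_ i isT)/eqP.
by rewrite sqrf_eq0 => /eqP.
Qed.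

Lemma euclidean_ballE z : euclidean_ball R k z <-> euclidean_norm z <= 1.
Proof.
have ge0 : 0 <= \sum_(i < k) z 0 i ^+ 2 by apply: sumr_ge0 => j _; exact: sqr_ge0.
rewrite /euclidean_ball /euclidean_norm /= -{2}[1]sqrtr1.
by rewrite ler_sqrt.
Qed.

End Coordinates.

(** * Inverse maps between the link of the region and the ball *)

Section BallMaps.
Variables (R : realType) (k : nat) (T : finType) (e : {set 'I_k.+2} -> T).
Variable N : pred {perm 'I_k.+2}.
Hypothesis e_inj : {in @proper_subset k.+2 &, injective e}.
Hypothesis N_up : forall s t : {perm 'I_k.+2}, N s ->
  (forall a b : 'I_k.+2, (b < a)%N -> (s b < s a)%N -> (t b < t a)%N) -> N t.
Hypothesis N_neq0 : exists s, N s.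
Hypothesis N_nmax : forall s, N s ->
  exists a b : 'I_k.+2, (b < a)%N && (s b < s a)%N.
Implicit Types (w : T -> R) (z : 'rV[R]_k) (x : 'I_k.+2 -> R).

Definition flag_complex : set {fset T} :=
  [set t : {fset T} | exists2 s, N s & forall v, v \in t ->
     exists S, [/\ proper_subset S, upset s S & v = e S]]%classic.

Lemma realizationP w : geometric_realization R flag_complex w <->
  exists2 s, N s &
    [/\ forall S, proper_subset S -> 0 <= w (e S),
        forall S, proper_subset S -> ~~ upset s S -> w (e S) = 0,
        forall v, (forall S, proper_subset S -> v != e S) -> w v = 0
      & \sum_(S | proper_subset S) w (e S) = 1].
Proof.
have sumE : (forall v, (forall S, proper_subset S -> v != e S) -> w v = 0) ->
    \sum_(S | proper_subset S) w (e S) = \sum_v w v.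
  move=> w0; rewrite [RHS](bigID [pred v | v \in (e @: @proper_subset k.+2)%SET]) /=.
  rewrite [X in _ = _ + X]big1 ?addr0 => [|v vN].
    by rewrite big_imset //= => S U; exact: e_inj.
  by apply: w0 => S SP; apply: contra vN => /eqP->; apply: imset_f.
split=> [[t [[s Ns ts] w_ge0 w0 w1]]|[s Ns [w_ge0 w0 wN w1]]].
  have wN v : (forall S, proper_subset S -> v != e S) -> w v = 0.
    move=> vN; apply: w0; apply/negP => /ts[S [SP _ vE]].
    by have := vN S SP; rewrite vE eqxx.
  exists s => //; split=> // [S SP uS|].
    apply: w0; apply: contra uS => /ts[U [UP uU /e_inj]].
    by move=> /(_ SP UP) ->.
  rewrite sumE // -w1 [RHS]big_uniq ?fset_uniq //= [RHS]big_mkcond.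
  by apply: eq_bigr => v _; case: ifPn => // /w0.
exists [fset e S | S : {set 'I_k.+2} in [pred S : {set 'I_k.+2} | proper_subset S & upset s S]]%fset.
set t := imfset _ _ _.
have tN v : v \notin t -> w v = 0.
  move=> vt; have [[S [SP vE]]|noS] := pselect (exists S, proper_subset S /\ v = e S).
    rewrite vE w0 //; apply: contra vt => uS; rewrite vE.
    by apply/imfsetP; exists S => //; apply/andP.
  by apply: wN => S SP; apply/eqP => vE; apply: noS; exists S.
split.
- by exists s => // v /imfsetP[S /= /andP[SP uS] ->]; exists S.
- move=> v; have [/imfsetP[S /= /andP[SP _] ->]|/tN->//] := boolP (v \in t).
  exact: w_ge0.
- exact: tN.
rewrite big_uniq ?fset_uniq //= -w1 sumE // [LHS]big_mkcond.
by apply: eq_bigr => v _; case: ifPn => // /tN.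
Qed.

Definition cone_point w : 'I_k.+2 -> R := superpose (fun S => w (e S)).

(** Horizontal norm plus vertical distance to the graph of the height: positively homogeneous, and
    positive on the nonconstant points of the region. The slice of radius one projects bijectively
    to the unit ball, its vertical distance being one minus the norm. *)
Definition radius x : R :=
  euclidean_norm (residue x) + (rise x - height N (lift_row (residue x))).

Definition to_ball w : 'rV[R]_k :=
  (radius (cone_point w))^-1 *: residue (cone_point w).

(** The point of radius one over [z]; it lies in the region exactly when the norm of [z] is at most
    one. *)
Definition lift_point z : 'I_k.+2 -> R := fun i =>
  lift_row z i + (1 - euclidean_norm z + height N (lift_row z)) * i%:R.

(** The sum has at most one term, as [e] is injective on proper subsets; it is empty at the vertices
    that [e] misses. *)
Definition of_ball z : T -> R := fun v =>
  (\sum_(S | proper_subset S && (e S == v)) gap S (lift_point z)) / total (lift_point z).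

Lemma of_ball_e z S : proper_subset S ->
  of_ball z (e S) = gap S (lift_point z) / total (lift_point z).
Proof.
move=> SP; rewrite /of_ball (big_pred1 S) // => U /=.
by apply/andP/eqP => [[UP /eqP/e_inj->//]|->]; rewrite ?eqxx.
Qed.

Lemma height_affine x c : 0 < c ->
  height N (fun i => c * x i) = c * height N x.
Proof. exact: height_homogeneous. Qed.

(** Radius zero would make the cone point constant, so its total gap would be zero; but that total
    is the sum of the barycentric coordinates. *)
Lemma radius_gt0 w : geometric_realization R flag_complex w ->
  0 < radius (cone_point w).
Proof.
move=> /realizationP[s Ns [w_ge0 w0 wN w1]].
set x := cone_point w; have sx : in_chamber s x by exact: superpose_chamber.
have total1 : total x = 1.
  rewrite -w1; apply: eq_bigr => S SP.
  exact: (gap_superpose SP w_ge0 w0).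
have hx : height N (lift_row (residue x)) <= rise x.
  apply/(height_le N_up N_neq0 N_nmax).
  have := region_affine (- x ord0) ler01 (ex_intro2 _ _ s Ns sx).
  by congr (region _ _); apply/funext => i; rewrite mul1r (coordinatesE x i) addrK.
rewrite lt_neqAle addr_ge0 ?euclidean_norm_ge0 ?subr_ge0 // andbT eq_sym.
apply/eqP => /eqP; rewrite paddr_eq0 ?euclidean_norm_ge0 ?subr_ge0 //.
move=> /andP[/eqP/euclidean_norm_eq0 r0]; rewrite r0 => /eqP.
have -> : lift_row (0 : 'rV[R]_k) = (fun=> 0) by apply/funext => i; rewrite lift_row0.
rewrite (height0 _ N_up N_neq0 N_nmax) subr0 => rise0.
have x_cst i : x i = 0 * x i + x ord0.
  by rewrite mul0r add0r {1}coordinatesE r0 rise0 lift_row0 mul0r !add0r.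
have := total_affine x (x ord0) (lexx 0).
have -> : (fun i => 0 * x i + x ord0) = x by apply/funext => i; rewrite -x_cst.
by rewrite mul0r total1 => /eqP; rewrite oner_eq0.
Qed.

Lemma total_lift_gt0 z : 0 < total (lift_point z).
Proof.
rewrite lt_neqAle total_ge0 andbT eq_sym; apply/eqP => /total_eq0 cst.
have rise0 : rise (lift_point z) = 0 by rewrite /rise (cst _ ord0) subrr.
have : residue (lift_point z) = 0.
  by apply/rowP => j; rewrite !mxE rise0 (cst _ ord0) subrr mul0r subr0.
move: rise0; rewrite residue_lift rise_lift => + z0; rewrite z0.
have -> : lift_row (0 : 'rV[R]_k) = (fun=> 0) by apply/funext => i; rewrite lift_row0.
rewrite (height0 _ N_up N_neq0 N_nmax) /euclidean_norm big1 => [|i _].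
  by rewrite sqrtr0 subr0 addr0 => /eqP; rewrite oner_eq0.
by rewrite mxE expr0n.
Qed.

Lemma to_ball_ball w : geometric_realization R flag_complex w ->
  euclidean_ball R k (to_ball w).
Proof.
move=> wr; have r0 := radius_gt0 wr; apply/euclidean_ballE.
rewrite /to_ball euclidean_normZ ?invr_ge0 ?(ltW r0) // ler_pdivrMl // mulr1.
rewrite /radius lerDl subr_ge0; apply/(height_le N_up N_neq0 N_nmax).
move: wr => /realizationP[s Ns [w_ge0 w0 wN w1]].
have sx : in_chamber s (cone_point w) by exact: superpose_chamber.
have := region_affine (- cone_point w ord0) ler01 (ex_intro2 _ _ s Ns sx).
by congr (region _ _); apply/funext => i; rewrite mul1r (coordinatesE (cone_point w) i) addrK.
Qed.

Lemma of_ball_realization z : euclidean_ball R k z ->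
  geometric_realization R flag_complex (of_ball z).
Proof.
move=> /euclidean_ballE z1; have t0 := total_lift_gt0 z; apply/realizationP.
have [s Ns sz] : region N (lift_point z).
  by apply/(height_le N_up N_neq0 N_nmax); rewrite lerDr subr_ge0.
exists s => //; split=> [S SP|S SP nS|v vN|].
- by rewrite of_ball_e // divr_ge0 ?gap_ge0 ?ltW.
- by rewrite of_ball_e // (gap_not_upset sz) // mul0r.
- rewrite /of_ball big_pred0 ?mul0r // => S; apply/negP => /andP[SP /eqP vE].
  by have := vN S SP; rewrite vE eqxx.
under eq_bigr => S SP do rewrite of_ball_e //.
by rewrite -mulr_suml divff // gt_eqF.
Qed.

Lemma to_ballK w : geometric_realization R flag_complex w -> of_ball (to_ball w) = w.
Proof.
move=> wr; have r0 := radius_gt0 wr; set x := cone_point w in r0 *.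
move: wr => /realizationP[s Ns [w_ge0 w0 wN w1]].
have gapE S : proper_subset S -> gap S x = w (e S).
  by move=> SP; exact: (gap_superpose SP w_ge0 w0).
have total1 : total x = 1 by rewrite -w1; apply: eq_bigr => S SP; exact: gapE.
have r0' : 0 < (radius x)^-1 by rewrite invr_gt0.
(* Scaled to radius one, the cone point is the lift up to a constant, which the gaps ignore. *)
have liftE : lift_point (to_ball w) =
    fun i => (radius x)^-1 * x i + - ((radius x)^-1 * x ord0).
  apply/funext => i; rewrite /lift_point /to_ball lift_rowZ euclidean_normZ ?ltW //.
  have -> : lift_row ((radius x)^-1 *: residue x) =
      fun i => (radius x)^-1 * lift_row (residue x) i.
    by apply/funext => j; rewrite lift_rowZ.
  rewrite height_affine //; set c := (radius x)^-1.
  have cr : c * (euclidean_norm (residue x) +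
      (rise x - height N (lift_row (residue x)))) = 1 by rewrite mulVf ?gt_eqF.
  rewrite [x i]coordinatesE -[X in (X - _ + _) * _]cr; lra.
apply/funext => v.
have [[S [SP ->]]|noS] := pselect (exists S, proper_subset S /\ v = e S).
  rewrite of_ball_e // liftE total_affine ?ltW // gap_affine ?ltW // gapE // total1 mulr1.
  by rewrite mulrAC divff ?mul1r // gt_eqF.
have vN S : proper_subset S -> v != e S.
  by move=> SP; apply/eqP => vE; apply: noS; exists S.
rewrite wN // /of_ball big_pred0 ?mul0r // => S; apply/negP => /andP[SP /eqP vE].
by have := vN S SP; rewrite vE eqxx.
Qed.

Lemma of_ballK z : euclidean_ball R k z -> to_ball (of_ball z) = z.
Proof.
move=> zb; have t0 := total_lift_gt0 z; set x := lift_point z in t0 *.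
set c := (total x)^-1; have c0 : 0 < c by rewrite invr_gt0.
have [s Ns sz] : region N x.
  move/euclidean_ballE: zb => z1; apply/(height_le N_up N_neq0 N_nmax).
  by rewrite lerDr subr_ge0.
(* The gaps determine [x] up to a constant, and the normalization by [total] scales it by [c]. *)
have coneE : cone_point (of_ball z) =
    fun i => c * x i + (cone_point (of_ball z) ord0 - c * x ord0).
  have E i : cone_point (of_ball z) i = c * superpose (fun S => gap S x) i.
    rewrite /cone_point /superpose mulr_sumr; apply: eq_bigr => S SP.
    by rewrite of_ball_e // -/x mulrA [c * _]mulrC.
  apply/funext => i; have := superpose_gap i ord0 sz; rewrite !E => H.
  by rewrite -[superpose _ i](subrK (superpose (fun S => gap S x) ord0)) H; lra.
rewrite /to_ball /radius coneE residue_affine rise_affine residue_lift rise_lift.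
have -> : lift_row (c *: z) = fun i => c * lift_row z i.
  by apply/funext => i; rewrite lift_rowZ.
rewrite height_affine // euclidean_normZ ?ltW // -mulrBr -mulrDr scalerA.
(* The lift has radius one by construction. *)
rewrite [X in c * X](_ : _ = 1); last by lra.
by rewrite mulr1 mulVf ?scale1r // gt_eqF.
Qed.

End BallMaps.

(** * Continuity of the ball maps *)

Section Convergence.
Variables (R : realType) (Z : Type) (F : set_system Z).
Context {FF : Filter F}.
Local Open Scope classical_set_scope.

Lemma cvg_sumr (I : Type) (r : seq I) (P : pred I) (f : I -> Z -> R) (l : I -> R) :
  (forall i, P i -> f i z @[z --> F] --> l i) ->
  \sum_(i <- r | P i) f i z @[z --> F] --> \sum_(i <- r | P i) l i.
Proof. by move=> fl; apply: cvg_big => //; exact: add_continuous. Qed.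

Lemma cvg_minr (f g : Z -> R) (a b : R) : f @ F --> a -> g @ F --> b ->
  Order.min (f z) (g z) @[z --> F] --> Order.min a b.
Proof.
move=> fa gb; apply: continuous2_cvg fa gb.
by apply: (@continuous_min R _ fst snd (a, b)); [exact: cvg_fst|exact: cvg_snd].
Qed.

Lemma cvg_maxr (f g : Z -> R) (a b : R) : f @ F --> a -> g @ F --> b ->
  Order.max (f z) (g z) @[z --> F] --> Order.max a b.
Proof.
move=> fa gb; apply: continuous2_cvg fa gb.
by apply: (@continuous_max R _ fst snd (a, b)); [exact: cvg_fst|exact: cvg_snd].
Qed.

Lemma cvg_bigmin (I : Type) (r : seq I) (P : pred I) (f0 : Z -> R) (l0 : R)
    (f : I -> Z -> R) (l : I -> R) :
  f0 @ F --> l0 -> (forall i, P i -> f i z @[z --> F] --> l i) ->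
  \big[Order.min/f0 z]_(i <- r | P i) f i z @[z --> F] -->
    \big[Order.min/l0]_(i <- r | P i) l i.
Proof.
move=> f0l fl; elim: r => [|i r IHr].
  by rewrite big_nil; under eq_cvg do rewrite big_nil.
rewrite big_cons; under eq_cvg do rewrite big_cons.
by case: ifPn => // Pi; apply: cvg_minr => //; exact: fl.
Qed.

Lemma cvg_bigmax (I : Type) (r : seq I) (P : pred I) (f0 : Z -> R) (l0 : R)
    (f : I -> Z -> R) (l : I -> R) :
  f0 @ F --> l0 -> (forall i, P i -> f i z @[z --> F] --> l i) ->
  \big[Order.max/f0 z]_(i <- r | P i) f i z @[z --> F] -->
    \big[Order.max/l0]_(i <- r | P i) l i.
Proof.
move=> f0l fl; elim: r => [|i r IHr].
  by rewrite big_nil; under eq_cvg do rewrite big_nil.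
rewrite big_cons; under eq_cvg do rewrite big_cons.
by case: ifPn => // Pi; apply: cvg_maxr => //; exact: fl.
Qed.

Lemma cvg_row k (f : 'I_k -> Z -> R) (l : 'I_k -> R) :
  (forall j, f j z @[z --> F] --> l j) ->
  (\row_j f j z : 'rV[R]_k) @[z --> F] --> (\row_j l j : 'rV[R]_k).
Proof.
move=> fl; apply/cvg_mx_entourageP => A entA.
have : \forall z \near F, forall j, A (l j, f j z).
  apply: filter_forall => j; have /cvg_entourageP := fl j; exact.
apply: filterS => z H i j; rewrite !mxE; exact/mem_set.
Qed.

Section Coordinatewise.
Variables (n : nat) (f : Z -> 'I_n -> R) (x : 'I_n -> R).
Hypothesis fx : forall i, f z i @[z --> F] --> x i.

Lemma cvg_gap S : gap S (f z) @[z --> F] --> gap S x.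
Proof.
apply: cvg_maxr; first exact: cvg_cst.
apply: cvg_bigmin => [|p _]; last exact: cvgB.
apply: cvg_sumr => a _; apply: cvg_sumr => b _.
by apply: cvg_norm; exact: cvgB.
Qed.

Lemma cvg_total : total (f z) @[z --> F] --> total x.
Proof. by apply: cvg_sumr => S _; exact: cvg_gap. Qed.

Lemma cvg_slope p : slope p (f z) @[z --> F] --> slope p x.
Proof. by apply: cvgMr_tmp; exact: cvgB. Qed.

Lemma cvg_height (N : pred {perm 'I_n}) :
  height N (f z) @[z --> F] --> height N x.
Proof.
have cvg_max_slope s : max_slope s (f z) @[z --> F] --> max_slope s x.
  (* The picked ascent does not depend on the point, so the starting slope is the same function
     along the whole filter. *)
  rewrite /max_slope; case: pickP => [p0 _|_]; last exact: cvg_cst.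
  by apply: cvg_bigmax => [|p _]; exact: cvg_slope.
rewrite /height; case: pickP => [s0 _|_]; last exact: cvg_cst.
by apply: cvg_bigmin => [|s _]; exact: cvg_max_slope.
Qed.

End Coordinatewise.

Section Coordinates.
Variable k : nat.

Lemma cvg_lift_row (f : Z -> 'rV[R]_k) (z : 'rV[R]_k) i :
  f @ F --> z -> lift_row (f t) i @[t --> F] --> lift_row z i.
Proof.
move=> fz; rewrite /lift_row; case: (@split_ordP 2 k i) => j ->.
  by rewrite row_mxEl; under eq_cvg do rewrite row_mxEl; exact: cvg_cst.
rewrite row_mxEr; under eq_cvg do rewrite row_mxEr.
apply: (@continuous_cvg _ _ _ F _ f (fun M : 'rV[R]_k => M 0 j) z) fz.
exact: coord_continuous.
Qed.

Lemma cvg_euclidean_norm (f : Z -> 'rV[R]_k) (z : 'rV[R]_k) :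
  f @ F --> z -> euclidean_norm (f t) @[t --> F] --> euclidean_norm z.
Proof.
move=> fz; apply: (@continuous_cvg _ _ _ F _ _ (@Num.sqrt R)); first exact: sqrt_continuous.
apply: cvg_sumr => i _; rewrite expr2; under eq_cvg do rewrite expr2.
have fi : f t 0 i @[t --> F] --> z 0 i.
  apply: (@continuous_cvg _ _ _ F _ f (fun M : 'rV[R]_k => M 0 i) z) fz.
  exact: coord_continuous.
exact: cvgM.
Qed.

Variables (f : Z -> 'I_k.+2 -> R) (x : 'I_k.+2 -> R).
Hypothesis fx : forall i, f z i @[z --> F] --> x i.

Lemma cvg_rise : rise (f z) @[z --> F] --> rise x.
Proof. exact: cvgB. Qed.

Lemma cvg_residue : residue (f z) @[z --> F] --> residue x.
Proof.
apply: cvg_row => j; apply: cvgB; first exact: cvgB.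
by apply: cvgMr_tmp; exact: cvg_rise.
Qed.

Lemma cvg_radius (N : pred {perm 'I_k.+2}) : radius N (f z) @[z --> F] --> radius N x.
Proof.
apply: cvgD; first exact/cvg_euclidean_norm/cvg_residue.
apply: cvgB; first exact: cvg_rise.
by apply: cvg_height => i; apply: cvg_lift_row; exact: cvg_residue.
Qed.

End Coordinates.
End Convergence.

Section SimplicialBall.
Variables (R : realType) (k : nat) (T : finType) (e : {set 'I_k.+2} -> T).
Variable N : pred {perm 'I_k.+2}.
Hypothesis e_inj : {in @proper_subset k.+2 &, injective e}.
Hypothesis N_up : forall s t : {perm 'I_k.+2}, N s ->
  (forall a b : 'I_k.+2, (b < a)%N -> (s b < s a)%N -> (t b < t a)%N) -> N t.
Hypothesis N_neq0 : exists s, N s.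
Hypothesis N_nmax : forall s, N s ->
  exists a b : 'I_k.+2, (b < a)%N && (s b < s a)%N.
Local Open Scope classical_set_scope.

(** The map divides by the radius, which is known to be positive on the realization; hence
    continuity within that subset. *)
Lemma continuous_to_ball :
  {within geometric_realization R (flag_complex e N),
    continuous (to_ball e N : {ptws T -> R} -> 'rV[R]_k)}.
Proof.
apply: continuous_in_subspaceT => w /set_mem wr.
have wv v : (u : {ptws T -> R}) v @[u --> w] --> w v.
  exact: (@proj_continuous T (fun=> R) v w).
have cone i : cone_point e (u : {ptws T -> R}) i @[u --> w] --> cone_point e w i.
  rewrite /cone_point /superpose.
  apply: (@cvg_sumr R {ptws T -> R} (nbhs w) _ _ _ _
    (fun S u => u (e S) * (i \in S)%:R) (fun S => w (e S) * (i \in S)%:R)) => S _.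
  apply: cvgMr_tmp; exact: wv.
have res := @cvg_residue R {ptws T -> R} (nbhs w) (nbhs_filter w) k (cone_point e) (cone_point e w) cone.
have rad := @cvg_radius R {ptws T -> R} (nbhs w) (nbhs_filter w) k (cone_point e) (cone_point e w) cone N.
have rad0 : radius N (cone_point e w) != 0.
  by rewrite gt_eqF // (radius_gt0 e_inj N_up N_neq0 N_nmax).
have lim := cvgZ (cvgV rad0 rad) res; exact: lim.
Qed.

Lemma continuous_of_ball_coordinate v : continuous (of_ball e N ^~ v : 'rV[R]_k -> R).
Proof.
move=> z.
have lr j := @cvg_lift_row R 'rV[R]_k (nbhs z) (nbhs_filter z) k id z j cvg_id.
have norm := @cvg_euclidean_norm R 'rV[R]_k (nbhs z) (nbhs_filter z) k id z cvg_id.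
have ht := @cvg_height R 'rV[R]_k (nbhs z) (nbhs_filter z) k.+2 _ (lift_row z) lr N.
have lift i : lift_point N t i @[t --> z] --> lift_point N z i.
  have FF := nbhs_filter z.
  have one : (fun _ : 'rV[R]_k => 1 : R) @ z --> (1 : R) by exact: cvg_cst.
  have lim := cvgD (cvgB one norm) ht.
  have {}lim := cvgD (lr i) (cvgMr_tmp (b := i%:R) (lim _ _)); exact: lim.
have tot := @cvg_total R 'rV[R]_k (nbhs z) (nbhs_filter z) k.+2 (lift_point N) (lift_point N z) lift.
have tot0 : total (lift_point N z) != 0.
  by rewrite gt_eqF // (total_lift_gt0 N_up N_neq0 N_nmax).
have gaps := @cvg_sumr R 'rV[R]_k (nbhs z) (nbhs_filter z) _ (index_enum _)
  (fun S => proper_subset S && (e S == v)) (fun S t => gap S (lift_point N t))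
  (fun S => gap S (lift_point N z)) (fun S _ => @cvg_gap R 'rV[R]_k (nbhs z) (nbhs_filter z) k.+2 _ _ lift S).
have lim := cvgM gaps (cvgV tot0 tot); exact: lim.
Qed.

Lemma continuous_of_ball : continuous (of_ball e N : 'rV[R]_k -> {ptws T -> R}).
Proof.
move=> z; have FF : Filter (of_ball e N x @[x --> z]) by exact: (@fmap_filter _ _ (of_ball e N) (nbhs z) (nbhs_filter z)).
(* The product topology is the supremum of the initial topologies of the coordinates. *)
apply/cvg_sup => v; move: z {FF}.
apply: (@continuous_comp_initial _ _ _ (fun w : T -> R => w v) (of_ball e N)).
exact: continuous_of_ball_coordinate.
Qed.

Lemma flag_complex_ball : simplicial_ball R (flag_complex e N).
Proof.
split.
  split=> [|t u [s Ns ts] /fsubsetP ut]; last by exists s => // v /ut/ts.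
  by have [s Ns] := N_neq0; exists s.
exists k, (to_ball e N), (of_ball e N); split.
- by split; [exact: continuous_to_ball|apply: continuous_subspaceT; exact: continuous_of_ball].
- by move=> _ [w wr <-]; exact: to_ball_ball.
- by move=> _ [z zb <-]; exact: of_ball_realization.
- by move=> w wr; exact: to_ballK.
- by move=> z zb; exact: of_ballK.
Qed.

End SimplicialBall.

(** * Assembling the decomposition *)

Section EarDecomposition.
Variables (R : realType) (disp : Order.disp_t) (L : finTBLatticeType disp).
Variables (n : nat) (c : nat -> L) (N : nat) (D : 'I_N.+1 -> {set L}).
Hypotheses (c0 : c 0%N = \bot%O) (cn : c n = \top%O).
Hypothesis c_covers : forall k, (k < n)%N -> covers (c k) (c k.+1).
Hypothesis D_frame : forall i, distributive_frame n c (D i).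
Hypothesis D_onto : forall i S, exists2 u, u \in D i & labels n c u = S.
Hypothesis D_inj : injective D.
Hypothesis D_cover : forall d : {set L}, chain (mem d) -> exists i, d \subset D i.
Implicit Types (i : 'I_N.+1) (t : {fset L}) (v : L) (S : {set 'I_n}).

Local Notation labels := (labels n c).
Local Notation ear := (ear n c D).
Local Notation elt := (elt c D).
Local Notation new := (new c D).
Local Notation flag := (flag c D).
Local Notation P := (@dual_permutohedron R n).

Definition realize v : 'rV[R]_n := vec R (labels v).

Let eltE i S : elt i S \in D i /\ labels (elt i S) = S := eltP D_onto i S.
Let eltK i : {in D i, cancel labels (elt i)} := labelsK c0 cn c_covers D_frame D_onto (i := i).
Let properE i v : v \in D i -> (v \in @proper_part _ L) = proper_subset (labels v) :=
  @proper_labels _ _ _ _ _ _ c0 cn c_covers D_frame i v.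
Let flagE i s v := in_flag c0 cn c_covers D_frame D_onto i s v.

Lemma ear_mem i t : ear i t ->
  exists2 s, new i s & {in t, forall v, [/\ v \in D i, proper_subset (labels v) & upset s (labels v)]}.
Proof.
move=> [s new_s /fsubsetP ts]; exists s => // v /ts.
by rewrite flagE => /and3P[vD + uv]; rewrite (properE vD).
Qed.

Lemma realize_inj i : {in complex_vertices (ear i) &, injective realize}.
Proof.
have H v : v \in complex_vertices (ear i) -> v \in D i /\ proper_subset (labels v).
  by move=> /set_mem/ear_mem[s _ /(_ v (fset11 v))[]].
move=> u v /H[uD uP] /H[vD vP] /(vec_inj uP vP) E.
exact: (labels_inj c0 cn c_covers (D_frame i) uD vD E).
Qed.

Lemma ear_in_boundary i t : ear i t -> boundary_complex P (realize @` t)%fset.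
Proof.
move=> /ear_mem[s _ ts]; rewrite boundary_dual_permutohedron.
exists [set S | elt i S \in t]%SET.
  have H S : S \in [set S | elt i S \in t]%SET -> proper_subset S /\ upset s S.
    by rewrite inE => /ts; rewrite (eltE i S).2 => -[_ ? ?].
  split=> [S /H[] //|S U /H[_ uS] /H[_ uU]]; exact: upset_comparable uS uU.
apply/fsetP => x; apply/imfsetP/imfsetP => [[v /= vt ->]|[S /=]].
  by exists (labels v) => //=; rewrite inE eltK //; case: (ts v vt).
by rewrite inE => St ->; exists (elt i S) => //; rewrite /realize (eltE i S).2.
Qed.

(** No frame precedes [D ord0], so all its flags are new and the ear is the full Coxeter complex. *)
Lemma first_ear_iso : complex_iso (ear ord0) (boundary_complex P).
Proof.
exists realize; split; first exact: realize_inj.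
apply/seteqP; split=> [x|_ [t /ear_in_boundary ? <-] //].
rewrite boundary_dual_permutohedron => -[tau [tauP tau_ch] ->].
have [s [s_up _]] := @chain_chamber n tau val val_inj tau_ch.
exists [fset elt ord0 S | S : {set 'I_n} in tau]%fset.
  exists s; first exact: new_first.
  apply/fsubsetP => _ /imfsetP[S /= St ->]; have [eD eE] := eltE ord0 S.
  by rewrite flagE eD (properE eD) eE tauP ?s_up.
apply/fsetP => y; apply/imfsetP/imfsetP => [[_ /= /imfsetP[S /= St ->] ->]|[S /= St ->]].
  by exists S => //; rewrite /realize (eltE ord0 S).2.
exists (elt ord0 S); last by rewrite /realize (eltE ord0 S).2.
by apply/imfsetP; exists S.
Qed.

Lemma new_ascent i s : (0 < i)%N -> new i s ->
  exists a b : 'I_n, (b < a)%N && (s b < s a)%N.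
Proof.
move=> i0; apply: contraPP => no; apply/negP.
apply: (decreasing_not_new c0 cn c_covers D_frame D_onto i0) => a b ab.
have [//|ba|/val_inj E] := ltngtP b a; last by rewrite E ltnn in ab.
by case: no; exists b, a; rewrite ba.
Qed.

Lemma ear_proper i : (0 < i)%N ->
  exists (m : nat) (Q : set 'rV[R]_m) (K : set {fset 'rV[R]_m}),
    [/\ simplicial_polytope Q n.-1, subcomplex K (boundary_complex Q),
        K <> boundary_complex Q & complex_iso (ear i) K].
Proof.
move=> i0; pose K := [set (realize @` t)%fset | t in ear i]%classic.
exists n, P, K; split.
- exact: simplicial_dual_permutohedron.
- split=> [|_ [t /ear_in_boundary ? <-] //].
  have [ear0 ear_down] := ear_complex c0 cn c_covers D_frame D_onto D_inj i.
  split=> [|_ y [t eart <-] /fsubsetP yt].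
    exists fset0 => //; apply/fsetP => x; rewrite inE; apply/negbTE/imfsetP.
    by move=> -[v].
  exists [fset v in t | realize v \in y]%fset.
    apply: ear_down eart _; apply/fsubsetP => v; by rewrite !inE => /andP[].
  apply/fsetP => x; apply/imfsetP/idP => [[v /=]|xy].
    by rewrite !inE => /andP[_ vy] ->.
  have /imfsetP[v /= vt xE] := yt x xy.
  by exists v => //; rewrite !inE /= vt -xE.
(* The reversal gives the decreasing flag; it is not new, so the corresponding facet of the boundary
   complex is missing from [K]. *)
- move=> KE; pose s : {perm 'I_n} := perm (@rev_ord_inj n).
  have s_decr (a b : 'I_n) : (s a < s b)%N -> (b < a)%N.
    rewrite !permE /= ltnNge; apply: contraTT => /=; rewrite -leqNgt negbK => ab.
    by rewrite leq_sub2l // ltnS.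
  have /negP := decreasing_not_new c0 cn c_covers D_frame D_onto i0 s_decr; apply.
  pose tau := [set level s (val k).+1 | k : 'I_n.-1]%SET.
  have levelP (k : 'I_n.-1) : proper_subset (level s k.+1).
    by apply: level_proper; rewrite /= -ltn_predRL.
  have : boundary_complex P [fset vec R S | S : {set 'I_n} in tau]%fset.
    rewrite boundary_dual_permutohedron; exists tau => //.
    split=> [S /imsetP[k _ ->]|S U /imsetP[k _ ->] /imsetP[l _ ->]]; first exact: levelP.
    exact: upset_comparable (upset_level _ _) (upset_level _ _).
  rewrite -KE => -[t /ear_mem[s' new_s' tP] tE].
  suff <- : s' = s by [].
  apply: (flag_sub_eq c0 cn c_covers D_frame D_onto (i := i)) => v.
  rewrite flagE => /and3P[vD + uv]; rewrite (properE vD) => vP.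
  have [k /andP[k0 kn] vE] := proper_upset_level uv vP.
  have : vec R (labels v) \in (realize @` t)%fset.
    rewrite tE; apply/imfsetP; exists (labels v) => //=; rewrite vE.
    have kn' : (k.-1 < n.-1)%N by rewrite ltn_predRL prednK.
    by apply/imsetP; exists (Ordinal kn') => //=; rewrite prednK.
  move=> /imfsetP[u /= ut]; have [uD uP uu] := tP u ut.
  by move/(vec_inj vP uP) => ->.
- by exists realize; split; first exact: realize_inj.
Qed.

Lemma ear_ball i : (0 < i)%N -> simplicial_ball R (ear i).
Proof.
move=> i0; have [s0 new_s0] := new_exists c0 cn c_covers D_frame D_onto D_inj i.
have [a [b /andP[ba _]]] := new_ascent i0 new_s0.
(* An ascent takes two indices; this permits the form [k.+2] that the coordinates of the ball
   require. *)
have n2 : (1 < n)%N by apply: leq_ltn_trans (ltn_ord a); apply: leq_ltn_trans ba.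
have earE : ear i = [set t : {fset L} | exists2 s, new i s & forall v, v \in t ->
     exists S, [/\ proper_subset S, upset s S & v = elt i S]]%classic.
  apply/seteqP; split=> t.
    move=> /ear_mem[s new_s tP]; exists s => // v /tP[vD vP uv].
    by exists (labels v); rewrite eltK.
  move=> [s new_s tP]; exists s => //; apply/fsubsetP => v /tP[S [SP uS ->]].
  by have [eD eE] := eltE i S; rewrite flagE eD (properE eD) eE SP.
rewrite earE.
have := @new_ascent i ^~ i0.
have := new_upward c0 cn c_covers D_frame D_onto (i := i).
have := new_exists c0 cn c_covers D_frame D_onto D_inj i.
have : {in @proper_subset n &, injective (elt i)}.
  by move=> S U _ _ /(congr1 labels); rewrite !(eltE i _).2.
(* Generalizing over [new i] and [elt i] detaches the goal from the frames, so that [n] can be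
   destructed. *)
move: (new i) (elt i); clear -n2; case: n n2 => [|[|k]] // _ N' e e_inj N_neq0 N_up N_nmax.
exact: (@flag_complex_ball R k L e N' e_inj N_up N_neq0 N_nmax).
Qed.

Lemma ears_decomposition : admits_convex_ear_decomposition R (order_complex (@proper_part _ L)).
Proof.
exists n.-1; split.
- exact: order_complex_complex.
- exact: (order_complex_card_dim c0 cn c_covers D_frame D_onto D_inj D_cover).
exists N, ear; split.
- exact: (ear_subcomplex c0 cn c_covers D_frame D_onto D_inj).
- exact: (ear_cover c0 cn c_covers D_frame D_onto D_inj D_cover).
- exists n, P; split; [exact: simplicial_dual_permutohedron|exact: first_ear_iso].
- by move=> i i0; split; [exact: (ear_card_dim c0 cn c_covers D_frame D_onto D_inj)|exact: ear_proper].
by move=> i i0; split; [exact: ear_ball|exact: (boundary_ear c0 cn c_covers D_frame D_onto D_inj)].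
Qed.

End EarDecomposition.

Theorem theorem3p2 (R : realType) (disp : Order.disp_t)
    (L : finTBLatticeType disp)
    (L_supersolvable : supersolvable L)
    (mobius_neq0 : forall x y : L, (x < y)%O -> mobius x y <> 0) :
  admits_convex_ear_decomposition R (order_complex (@proper_part disp L)).
Proof.
have [C [maxC C_dist]] := L_supersolvable.
have [n [c [c0 cn c_covers CP]]] := maximal_chain_enum maxC.
pose boolean (D : {set L}) := distributive_frame n c D /\
  forall S, exists2 u, u \in D & labels n c u = S.
(* All Boolean frames, in whatever order [enum] lists them; the absence of repetitions gives the
   injectivity of [D]. *)
pose Ds := enum [pred D : {set L} | `[< boolean D >]].
have mem_Ds D : D \in Ds <-> boolean D by rewrite mem_enum inE.
have cover (d : {set L}) : chain (mem d) -> exists2 D, D \in Ds & d \subset D.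
  move=> chd; have [D [frD dD onD]] :=
    boolean_frame_cover c0 cn c_covers CP C_dist mobius_neq0 chd.
  by exists D => //; apply/mem_Ds.
have Ds_gt0 : (0 < size Ds)%N.
  have [x y|D + _] := cover finset.set0; first by rewrite inE.
  by rewrite -index_mem; exact: leq_ltn_trans.
(* The list is nonempty because the empty chain is covered, so its size can be written as a
   successor. *)
pose D (i : 'I_(size Ds).-1.+1) := nth finset.set0 Ds i.
have iDs (i : 'I_(size Ds).-1.+1) : (i < size Ds)%N by rewrite -[X in (_ < X)%N](prednK Ds_gt0).
have DP i : boolean (D i) by apply/mem_Ds; exact: mem_nth.
apply: (@ears_decomposition R _ _ n c _ D) => //.
- by move=> i; have [] := DP i.
- by move=> i; have [] := DP i.
- move=> i j /eqP; rewrite nth_uniq ?iDs ?enum_uniq // => /eqP; exact: val_inj.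
move=> d /cover[D' D's dD']; have D'i : (index D' Ds < (size Ds).-1.+1)%N.
  by rewrite prednK // index_mem.
by exists (Ordinal D'i); rewrite /D /= nth_index.
Qed.
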